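(* Let $\psi\in\Sigma$ and $Q_e(z,w)=\log\frac{\psi(z)-\psi(w)}{z-w}$. For integers $n=1,2,3,\dots$ and $m=0,\dots,n-1$, $$(\partial_z^n\partial_w^mQ_e)(z,z)=\frac{n-m}{2}\sum_{k=m}^{\lfloor\frac{m+n}{2}\rfloor}\frac{(-1)^{k+m}}{n-k}\binom{n-k}{k-m}\,\partial_z^{n+m-2k}\,\mathrm{S}_{2k}(\psi)(z),\qquad z\in\mathbb{D}_e.$$
   Context: $\mathbb{D}_e=\{z\in\mathbb{C}:|z|>1\}$. $\Sigma$ is the class of univalent (injective holomorphic) functions $\psi:\mathbb{D}_e\to\mathbb{C}$ with Laurent expansion $\psi(z)=z+b_0+b_1z^{-1}+\cdots$. $Q_e$ is the holomorphic function on $\mathbb{D}_e^2$ (quotient read as $\psi'(z)$ on $z=w$) given by the branch of the logarithm vanishing when $z=\infty$ or $w=\infty$. The diagonal series Schwarzian derivatives are $\mathrm{S}_{2k}(\psi)(z)=(\partial_z^k\partial_w^kQ_e)(z,z)$, $k=0,1,2,\dots$. $\lfloor\cdot\rfloor$ is the integer part. *)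

(* Defs.v *)
From Stdlib Require Import Reals.
From Coquelicot Require Import Coquelicot.

Open Scope C_scope.

Definition De (z : C) : Prop := (1 < Cmod z)%R.

(* Neighbourhoods of the point at infinity of the Riemann sphere. *)
Definition C_infty (P : C -> Prop) : Prop :=
  exists M : R, forall z : C, (M < Cmod z)%R -> P z.

Definition Cexp (z : C) : C :=
  ((exp (Re z) * cos (Im z))%R, (exp (Re z) * sin (Im z))%R).

(* A function on [De] is represented by a total function on [C] whose values
   outside [De] are irrelevant, [De] being open. *)
Definition Sigma_class (psi : C -> C) : Prop :=
  (forall z : C, De z -> @ex_derive C_AbsRing C_NormedModule psi z) /\
  (forall z w : C, De z -> De w -> psi z = psi w -> z = w) /\
  (exists b : nat -> C, forall z : C, De z ->
     @is_series C_AbsRing C_NormedModule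
       (fun j => b j * (/ z) ^ j) (psi z - z)).

(* Complex Frechet differentiability at every point of [De * De]. *)
Definition holomorphic_De2 (F : C -> C -> C) : Prop :=
  forall z w : C, De z -> De w ->
    @ex_filterdiff C_AbsRing
      (prod_NormedModule C_AbsRing C_NormedModule C_NormedModule)
      C_NormedModule
      (fun p : C * C => F (fst p) (snd p)) (locally (z, w)).

Definition diff_quot (psi : C -> C) (z w : C) : C :=
  if Ceq_dec z w then C_derive psi z else (psi z - psi w) / (z - w).

(* [Q] is the branch on [De * De] of log ((psi z - psi w) / (z - w)) that
   vanishes when z or w is infinity; since [De] is connected, the values of
   [Q] on [De * De] are determined by [psi]. *)
Definition is_Qe (psi : C -> C) (Q : C -> C -> C) : Prop :=
  holomorphic_De2 Q /\
  (forall z w : C, De z -> De w -> Cexp (Q z w) = diff_quot psi z w) /\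
  (forall w : C, De w -> filterlim (fun z => Q z w) C_infty (locally (RtoC 0))) /\
  (forall z : C, De z -> filterlim (fun w => Q z w) C_infty (locally (RtoC 0))).

(* [C_derive] is total: it takes the limit of the difference quotient along
   horizontal increments, which is the complex derivative wherever the latter
   exists (is_C_derive_unique). *)
Fixpoint C_derive_n (f : C -> C) (n : nat) (z : C) : C :=
  match n with
  | O => f z
  | S n' => C_derive (C_derive_n f n') z
  end.

(* n derivatives in the first variable of m derivatives in the second. *)
Definition C_partial (n m : nat) (F : C -> C -> C) (z w : C) : C :=
  C_derive_n (fun u => C_derive_n (fun v => F u v) m w) n z.

(* For [is_Qe psi Q], [diag_schwarzian Q k] is S_{2k}(psi). *)
Definition diag_schwarzian (Q : C -> C -> C) (k : nat) (z : C) : C :=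
  C_partial k k Q z z.

(* Main.v *)
Require Import Defs.
From Stdlib Require Import Reals Factorial Lra Lia Psatz.
From Coquelicot Require Import Coquelicot.
Local Open Scope C_scope.

(* Write [A n m z] for the mixed partial of [Q] of order (n, m) on the
   diagonal. Since partials commute, the derivative of [A n m] is
   [A (S n) m + A n (S m)], and [A] is symmetric because [Q] is. Hence
   [2 A (m + d) m] satisfies in [d] a Lucas-type recurrence
   [a_(d+2) = a_(d+1)' - (shift of a_d)], whose solution has the coefficients
   [(-1)^j d / (d - j) C(d - j, j)].

   Smoothness of [Q] needs no Cauchy theory: with x = 1/z, y = 1/w and psi
   given by its Laurent coefficients b_j, the difference quotient is
   [1 - x y sum_(i,j) b_(i+j+1) x^i y^j], a double power series that may be
   differentiated termwise, and [Q] is a logarithm of it. *)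

(** * Complex differentiability in two variables *)

(** With X and Y for differentiation in z and w, the coefficients are those of Waring's formula
    expressing X^d + Y^d through X + Y and X Y. On the diagonal X + Y acts as d/dz, (X Y)^k Q
    restricts to S_2k, and the symmetry of Q turns X^d + Y^d into 2 X^d; hence the factor 1/2. The
    definition of Q grants one complex derivative only. Differentiating exp Q = quotient identifies
    it with an expression in which Q no longer occurs, and every further derivative comes from that
    expression. Derivatives are taken jointly in both variables, as the chain rule along the
    diagonal requires; [cdiff2] carries the two partials as explicit data. Symmetry of the quotient
    gives symmetry of Q only up to a multiple of 2 pi i, which the normalization at infinity
    removes. *)

Definition cdiff2 (F : C -> C -> C) (z w a b : C) : Prop :=
  forall eps : R, (0 < eps)%R -> exists delta : R, (0 < delta)%R /\
    forall h k : C, (Cmod h < delta)%R -> (Cmod k < delta)%R ->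
    (Cmod (F (z + h) (w + k) - F z w - (a * h + b * k))%C <= eps * (Cmod h + Cmod k))%R.

Lemma cdiff2_ext_loc (F G : C -> C -> C) (z w a b : C) (r : R) :
  (0 < r)%R ->
  (forall h k, (Cmod h < r)%R -> (Cmod k < r)%R -> F (z + h) (w + k) = G (z + h) (w + k)) ->
  cdiff2 F z w a b -> cdiff2 G z w a b.
Proof.
intros Hr E H eps He. destruct (H eps He) as [d [Hd H']].
exists (Rmin d r). split; [now apply Rmin_glb_lt|].
intros h k Hh Hk.
assert (H0 := Rmin_l d r). assert (H1 := Rmin_r d r).
rewrite <- E by lra.
assert (E0 : F z w = G z w).
{ rewrite <- (Cplus_0_r z), <- (Cplus_0_r w). apply E; rewrite Cmod_0; lra. }
rewrite <- E0. apply H'; lra.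
Qed.

Lemma cdiff2_lipschitz (F : C -> C -> C) (z w a b : C) :
  cdiff2 F z w a b -> exists L delta : R, (0 < L)%R /\ (0 < delta)%R /\
    forall h k : C, (Cmod h < delta)%R -> (Cmod k < delta)%R ->
    (Cmod (F (z + h) (w + k) - F z w)%C <= L * (Cmod h + Cmod k))%R.
Proof.
intros H. destruct (H 1%R Rlt_0_1) as [d [Hd H']].
exists (1 + Cmod a + Cmod b)%R, d.
assert (Ha := Cmod_ge_0 a). assert (Hb := Cmod_ge_0 b).
split; [lra|]. split; [easy|]. intros h k Hh Hk.
specialize (H' h k Hh Hk).
replace (F (z + h) (w + k) - F z w) with
  ((F (z + h) (w + k) - F z w - (a * h + b * k)) + (a * h + b * k)) by ring.
eapply Rle_trans; [apply Cmod_triangle|].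
assert (H2 := Cmod_triangle (a * h) (b * k)). rewrite !Cmod_mult in H2.
assert (Hh0 := Cmod_ge_0 h). assert (Hk0 := Cmod_ge_0 k).
nra.
Qed.

(** The only chain rule of the development: sums, products, inverses, exchange of variables and
    restriction to a line or to the diagonal are all instances. *)
Lemma cdiff2_comp (E F G : C -> C -> C) (z w a b f1 f2 g1 g2 : C) :
  cdiff2 E (F z w) (G z w) a b ->
  cdiff2 F z w f1 f2 -> cdiff2 G z w g1 g2 ->
  cdiff2 (fun u v => E (F u v) (G u v)) z w (a * f1 + b * g1) (a * f2 + b * g2).
Proof.
intros HE HF HG eps He.
destruct (cdiff2_lipschitz _ _ _ _ _ HF) as [L [d1 [HL [Hd1 LF]]]].
destruct (cdiff2_lipschitz _ _ _ _ _ HG) as [M [d2 [HM [Hd2 LG]]]].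
set (N := (1 + Cmod a + Cmod b)%R).
assert (Ha := Cmod_ge_0 a). assert (Hb := Cmod_ge_0 b).
assert (HN : (0 < N)%R) by (unfold N; lra).
(* Half of [eps] pays for the remainder of [E], whose increments are at most (L + M) s in total; the
   other half pays for the remainders of [F] and [G], which get multiplied by [a] and [b]. *)
set (e1 := (eps / 2 / (L + M))%R).
assert (He1 : (0 < e1)%R) by (unfold e1; repeat apply Rdiv_lt_0_compat; lra).
set (e2 := (eps / 2 / N)%R).
assert (He2 : (0 < e2)%R) by (unfold e2; repeat apply Rdiv_lt_0_compat; lra).
destruct (HE e1 He1) as [d3 [Hd3 HE']].
destruct (HF e2 He2) as [d4 [Hd4 HF']].
destruct (HG e2 He2) as [d5 [Hd5 HG']].
set (d6 := (d3 / 2 / (L + M))%R).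
assert (Hd6 : (0 < d6)%R) by (unfold d6; repeat apply Rdiv_lt_0_compat; lra).
exists (Rmin (Rmin (Rmin d1 d2) (Rmin d4 d5)) d6).
split; [repeat apply Rmin_glb_lt; easy|].
intros h k Hh Hk.
assert (Q : forall t, (t < Rmin (Rmin (Rmin d1 d2) (Rmin d4 d5)) d6 ->
   t < d1 /\ t < d2 /\ t < d4 /\ t < d5 /\ t < d6)%R).
{ intros t Ht. revert Ht. unfold Rmin. repeat destruct Rle_dec; intros; lra. }
destruct (Q _ Hh) as [h1 [h2 [h4 [h5 h6]]]].
destruct (Q _ Hk) as [k1 [k2 [k4 [k5 k6]]]]. clear Q.
specialize (LF h k h1 k1). specialize (LG h k h2 k2).
specialize (HF' h k h4 k4). specialize (HG' h k h5 k5).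
set (dF := F (z + h) (w + k) - F z w) in *.
set (dG := G (z + h) (w + k) - G z w) in *.
assert (Hh0 := Cmod_ge_0 h). assert (Hk0 := Cmod_ge_0 k).
set (s := (Cmod h + Cmod k)%R) in *.
assert (Hs : (s < 2 * d6)%R) by (unfold s; lra).
assert (Hs0 : (0 <= s)%R) by (unfold s; lra).
assert (Hs3 : ((L + M) * s < d3)%R).
{ apply Rlt_le_trans with ((L + M) * (2 * d6))%R.
  - apply Rmult_lt_compat_l; lra.
  - apply Req_le. unfold d6. field. lra. }
assert (X : (Cmod (E (F z w + dF) (G z w + dG) - E (F z w) (G z w) - (a * dF + b * dG))%C <= e1 * (Cmod dF + Cmod dG))%R).
{ apply HE'; nra. }
replace (F z w + dF) with (F (z + h) (w + k)) in X by (unfold dF; ring).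
replace (G z w + dG) with (G (z + h) (w + k)) in X by (unfold dG; ring).
match goal with |- (Cmod ?t <= _)%R => replace t with
 ((E (F (z + h) (w + k)) (G (z + h) (w + k)) - E (F z w) (G z w) - (a * dF + b * dG))
  + (a * (dF - (f1 * h + f2 * k)) + b * (dG - (g1 * h + g2 * k)))) by ring end.
eapply Rle_trans; [apply Cmod_triangle|].
assert (Y := Cmod_triangle (a * (dF - (f1 * h + f2 * k))) (b * (dG - (g1 * h + g2 * k)))).
rewrite !Cmod_mult in Y.
assert (A1 : (e1 * (Cmod dF + Cmod dG) <= eps / 2 * s)%R).
{ apply Rle_trans with (e1 * ((L + M) * s))%R.
  - apply Rmult_le_compat_l; lra.
  - apply Req_le. unfold e1. field. lra. }
assert (A2 : (Cmod a * Cmod (dF - (f1 * h + f2 * k))%C + Cmod b * Cmod (dG - (g1 * h + g2 * k))%C <= eps / 2 * s)%R).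
{ apply Rle_trans with (N * (e2 * s))%R.
  - assert (0 <= e2 * s)%R by (apply Rmult_le_pos; lra). unfold N.
    assert (Cmod a * Cmod (dF - (f1 * h + f2 * k)) <= Cmod a * (e2 * s))%R by (apply Rmult_le_compat_l; lra).
    assert (Cmod b * Cmod (dG - (g1 * h + g2 * k)) <= Cmod b * (e2 * s))%R by (apply Rmult_le_compat_l; lra).
    nra.
  - apply Req_le. unfold e2. field. lra. }
lra.
Qed.

Lemma cdiff2_const (c z w : C) : cdiff2 (fun _ _ => c) z w 0 0.
Proof.
intros eps He. exists 1%R. split; [lra|]. intros h k _ _.
replace (c - c - (0 * h + 0 * k)) with (RtoC 0) by ring. rewrite Cmod_0.
assert (Hh0 := Cmod_ge_0 h). assert (Hk0 := Cmod_ge_0 k). nra.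
Qed.

Lemma cdiff2_fst (z w : C) : cdiff2 (fun u _ => u) z w 1 0.
Proof.
intros eps He. exists 1%R. split; [lra|]. intros h k _ _.
replace (z + h - z - (1 * h + 0 * k)) with (RtoC 0) by ring. rewrite Cmod_0.
assert (Hh0 := Cmod_ge_0 h). assert (Hk0 := Cmod_ge_0 k). nra.
Qed.

Lemma cdiff2_snd (z w : C) : cdiff2 (fun _ v => v) z w 0 1.
Proof.
intros eps He. exists 1%R. split; [lra|]. intros h k _ _.
replace (w + k - w - (0 * h + 1 * k)) with (RtoC 0) by ring. rewrite Cmod_0.
assert (Hh0 := Cmod_ge_0 h). assert (Hk0 := Cmod_ge_0 k). nra.
Qed.

Lemma cdiff2_plus (F G : C -> C -> C) (z w f1 f2 g1 g2 : C) :
  cdiff2 F z w f1 f2 -> cdiff2 G z w g1 g2 ->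
  cdiff2 (fun u v => F u v + G u v) z w (f1 + g1) (f2 + g2).
Proof.
intros HF HG.
replace (f1 + g1) with (1 * f1 + 1 * g1) by ring.
replace (f2 + g2) with (1 * f2 + 1 * g2) by ring.
apply (cdiff2_comp (fun x y => x + y)); try easy.
intros eps He. exists 1%R. split; [lra|]. intros h k _ _.
match goal with |- (Cmod ?t <= _)%R => replace t with (RtoC 0) by ring end. rewrite Cmod_0.
assert (Hh0 := Cmod_ge_0 h). assert (Hk0 := Cmod_ge_0 k). nra.
Qed.

Lemma cdiff2_mult (F G : C -> C -> C) (z w f1 f2 g1 g2 : C) :
  cdiff2 F z w f1 f2 -> cdiff2 G z w g1 g2 ->
  cdiff2 (fun u v => F u v * G u v) z w
    (f1 * G z w + F z w * g1) (f2 * G z w + F z w * g2).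
Proof.
intros HF HG.
replace (f1 * G z w + F z w * g1) with (G z w * f1 + F z w * g1) by ring.
replace (f2 * G z w + F z w * g2) with (G z w * f2 + F z w * g2) by ring.
apply (cdiff2_comp (fun x y => x * y)); try easy.
intros eps He. exists eps. split; [lra|]. intros h k Hh Hk.
match goal with |- (Cmod ?t <= _)%R => replace t with (h * k) by ring end.
rewrite Cmod_mult.
assert (Hh0 := Cmod_ge_0 h). assert (Hk0 := Cmod_ge_0 k). nra.
Qed.

Lemma cdiff2_inv (F : C -> C -> C) (z w f1 f2 : C) :
  F z w <> 0 -> cdiff2 F z w f1 f2 ->
  cdiff2 (fun u v => / F u v) z w
    (- (/ F z w * / F z w * f1)) (- (/ F z w * / F z w * f2)).
Proof.
intros H0 HF. set (p := F z w) in *.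
assert (Hi : cdiff2 (fun x _ => / x) p p (- (/ p * / p)) 0).
{ intros eps He.
  assert (Hp : (0 < Cmod p)%R) by now apply Cmod_gt_0.
  set (m := Cmod p) in *.
  (* The remainder is h^2 / (p^2 (p + h)). The first bound keeps |p + h| above m / 2, so the
     denominator is at least m^3 / 2; the second bound is [eps] times that. *)
  exists (Rmin (m / 2) (eps * m ^ 3 / 2)). split.
  { apply Rmin_glb_lt; [lra|]. apply Rdiv_lt_0_compat; [|lra].
    apply Rmult_lt_0_compat; [lra|]. now apply pow_lt. }
  intros h k Hh _.
  assert (Hh1 := Rlt_le_trans _ _ _ Hh (Rmin_l _ _)).
  assert (Hh2 := Rlt_le_trans _ _ _ Hh (Rmin_r _ _)).
  assert (Hq : (m / 2 <= Cmod (p + h))%R).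
  { assert (T := Cmod_triangle (p + h) (- h)). rewrite Cmod_opp in T.
    replace (p + h + - h) with p in T by ring. fold m in T. lra. }
  assert (Hph : p + h <> 0) by (apply Cmod_gt_0; lra).
  match goal with |- (Cmod ?t <= _)%R => replace t with (h * h * (/ p * / p * / (p + h))) by (field; split; easy) end.
  rewrite !Cmod_mult, !Cmod_inv by easy. fold m.
  assert (Hh0 := Cmod_ge_0 h). assert (Hk0 := Cmod_ge_0 k).
  assert (/ Cmod (p + h) <= / (m / 2))%R by (apply Rinv_le_contravar; lra).
  apply Rle_trans with (Cmod h * Cmod h * (/ m * / m * / (m / 2)))%R.
  { apply Rmult_le_compat_l; [nra|]. apply Rmult_le_compat_l; [|easy].
    apply Rlt_le, Rmult_lt_0_compat; now apply Rinv_0_lt_compat. }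
  apply Rle_trans with (Cmod h * (eps * m ^ 3 / 2) * (/ m * / m * / (m / 2)))%R.
  { apply Rmult_le_compat_r.
    - apply Rlt_le; repeat apply Rmult_lt_0_compat; apply Rinv_0_lt_compat; lra.
    - nra. }
  replace (Cmod h * (eps * m ^ 3 / 2) * (/ m * / m * / (m / 2)))%R with (eps * Cmod h)%R by (field; lra).
  nra. }
replace (- (/ p * / p * f1)) with (- (/ p * / p) * f1 + 0 * f1) by ring.
replace (- (/ p * / p * f2)) with (- (/ p * / p) * f2 + 0 * f2) by ring.
apply (cdiff2_comp (fun x _ => / x) F F); easy.
Qed.

(** One-variable functions are treated as functions ignoring the second argument, so that the chain
    rule above also yields derivatives along curves. *)
Lemma cdiff2_is_derive (f : C -> C) (z w l m : C) :
  cdiff2 (fun u _ => f u) z w l m -> @is_derive C_AbsRing C_NormedModule f z l.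
Proof.
intros H. split.
{ apply is_linear_scal_l. }
intros x Hx. rewrite <- (is_filter_lim_locally_unique _ _ Hx). clear x Hx.
intros eps. destruct (H eps (cond_pos eps)) as [d [Hd H']].
exists (mkposreal d Hd). intros y; change C in y; intros Hy.
change (Cmod (minus (minus (f y) (f z)) (scal (minus y z) l)) <= eps * Cmod (minus y z))%R.
change (Cmod (y - z) < d)%R in Hy.
specialize (H' (y - z) 0 Hy). rewrite Cmod_0 in H'.
specialize (H' Hd). replace (z + (y - z)) with y in H' by ring.
rewrite Rplus_0_r in H'.
replace (minus (minus (f y) (f z)) (scal (minus y z) l)) with
 (f y - f z - (l * (y - z) + m * 0)); [exact H'|].
change (@eq C (f y - f z - (l * (y - z) + m * 0)) (f y - f z - (y - z) * l)). ring.
Qed.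

Lemma cdiff2_is_derive_l (F : C -> C -> C) (z w a b : C) :
  cdiff2 F z w a b -> @is_derive C_AbsRing C_NormedModule (fun u => F u w) z a.
Proof.
intros H. apply cdiff2_is_derive with w (RtoC 0).
replace a with (a * RtoC 1 + b * RtoC 0) by ring.
replace (RtoC 0) with (a * 0 + b * 0) at 2 by ring.
apply (cdiff2_comp F (fun u _ => u) (fun _ _ => w)); [easy|apply cdiff2_fst|apply cdiff2_const].
Qed.

Lemma cdiff2_is_derive_r (F : C -> C -> C) (z w a b : C) :
  cdiff2 F z w a b -> @is_derive C_AbsRing C_NormedModule (fun v => F z v) w b.
Proof.
intros H. apply cdiff2_is_derive with z (RtoC 0).
replace b with (a * 0 + b * 1) by ring.
replace (RtoC 0) with (a * 0 + b * 0) at 2 by ring.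
apply (cdiff2_comp F (fun _ _ => z) (fun u _ => u)); [easy|apply cdiff2_const|apply cdiff2_fst].
Qed.

(** Source of the rule that the derivative of [A n m] is [A (S n) m + A n (S m)]. *)
Lemma cdiff2_is_derive_diag (F : C -> C -> C) (z a b : C) :
  cdiff2 F z z a b -> @is_derive C_AbsRing C_NormedModule (fun u => F u u) z (a + b).
Proof.
intros H. apply cdiff2_is_derive with z (RtoC 0).
replace (a + b) with (a * RtoC 1 + b * RtoC 1) by ring.
replace (RtoC 0) with (a * RtoC 0 + b * RtoC 0) by ring.
apply (cdiff2_comp F (fun u _ => u) (fun u _ => u)); [easy|apply cdiff2_fst|apply cdiff2_fst].
Qed.

Lemma holomorphic_De2_cdiff2 (F : C -> C -> C) (z w : C) :
  holomorphic_De2 F -> De z -> De w -> exists a b : C, cdiff2 F z w a b.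
Proof.
intros H Hz Hw. destruct (H z w Hz Hw) as [l [Hl Hd]]. clear H.
exists (l (RtoC 1, RtoC 0)), (l (RtoC 0, RtoC 1)). intros eps He.
assert (Hx : is_filter_lim (T := prod_UniformSpace C_UniformSpace C_UniformSpace) (locally (T := prod_UniformSpace C_UniformSpace C_UniformSpace) (z, w)) (z, w)) by (intros P HP; exact HP).
destruct (Hd _ Hx (mkposreal eps He)) as [d Hd'].
exists (pos d). split; [apply cond_pos|]. intros h k Hh Hk.
specialize (Hd' (z + h, w + k)).
assert (B : ball (M := prod_UniformSpace C_UniformSpace C_UniformSpace) (z, w) d (z + h, w + k)).
{ split; apply C_NormedModule_mixin_compat1; simpl.
  - replace (minus (z + h) z) with h; [easy|]. change (@eq C h (z + h - z)). ring.
  - replace (minus (w + k) w) with k; [easy|]. change (@eq C k (w + k - w)). ring. }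
specialize (Hd' B).
assert (Em : @minus (NormedModule.AbelianGroup C_AbsRing (prod_NormedModule C_AbsRing C_NormedModule C_NormedModule)) (z + h, w + k) (z, w) = (h, k)).
{ change (@eq (C * C) (z + h - z, w + k - w) (h, k)). f_equal; ring. }
rewrite Em in Hd'.
assert (Hlin : l (h, k) = l (RtoC 1, RtoC 0) * h + l (RtoC 0, RtoC 1) * k).
{ replace ((h, k) : C * C) with (plus (scal h ((RtoC 1, RtoC 0) : prod_NormedModule C_AbsRing C_NormedModule C_NormedModule)) (scal k ((RtoC 0, RtoC 1) : prod_NormedModule C_AbsRing C_NormedModule C_NormedModule))).
  - rewrite (linear_plus l Hl), !(linear_scal l Hl).
    change (@eq C (h * l (RtoC 1, RtoC 0) + k * l (RtoC 0, RtoC 1)) (l (RtoC 1, RtoC 0) * h + l (RtoC 0, RtoC 1) * k)). ring.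
  - change ((h * 1 + k * 0, h * 0 + k * 1) = (h, k)). f_equal; ring. }
(* The norm on the product space is Euclidean, and is bounded by |h| + |k| at the end. *)
change (Cmod (F (z + h) (w + k) - F z w - l (h, k))%C <= eps * sqrt (Cmod h ^ 2 + Cmod k ^ 2))%R in Hd'.
rewrite Hlin in Hd'.
eapply Rle_trans; [exact Hd'|]. apply Rmult_le_compat_l; [lra|].
assert (Hh0 := Cmod_ge_0 h). assert (Hk0 := Cmod_ge_0 k).
rewrite <- (sqrt_pow2 (Cmod h + Cmod k)) by lra. apply sqrt_le_1_alt. nra.
Qed.

(** * Absolutely convergent complex series *)

Fixpoint Csum (f : nat -> C) (n : nat) : C :=
  match n with O => 0 | S n' => Csum f n' + f n' end.

Lemma Csum_ext (f g : nat -> C) (n : nat) :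
  (forall i, (i < n)%nat -> f i = g i) -> Csum f n = Csum g n.
Proof. induction n as [|n IH]; intros H; simpl; [easy|]. rewrite IH, H; auto. Qed.

Lemma Csum_plus (f g : nat -> C) (n : nat) :
  Csum (fun i => f i + g i) n = Csum f n + Csum g n.
Proof. induction n as [|n IH]; simpl; [|rewrite IH]; ring. Qed.

Lemma Csum_scal (c : C) (f : nat -> C) (n : nat) :
  Csum (fun i => c * f i) n = c * Csum f n.
Proof. induction n as [|n IH]; simpl; [|rewrite IH]; ring. Qed.

Lemma Csum_first (f : nat -> C) (n : nat) :
  Csum f (S n) = f O + Csum (fun i => f (S i)) n.
Proof.
induction n as [|n IH]; [simpl; ring|].
change (Csum f (S (S n))) with (Csum f (S n) + f (S n)).
rewrite IH. simpl. ring.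
Qed.

Lemma Cmod_Csum_le (f : nat -> C) (n : nat) (B : R) :
  (forall i, (i < n)%nat -> (Cmod (f i) <= B)%R) -> (Cmod (Csum f n) <= INR n * B)%R.
Proof.
induction n as [|n IH]; intros H.
- simpl. rewrite Cmod_0. lra.
- rewrite S_INR. simpl. eapply Rle_trans; [apply Cmod_triangle|].
  assert (H1 := IH (fun i Hi => H i (Nat.lt_lt_succ_r _ _ Hi))).
  assert (H2 := H n (Nat.lt_succ_diag_r n)). lra.
Qed.

Lemma Cmod_le_Rabs (z : C) : (Cmod z <= Rabs (Re z) + Rabs (Im z))%R.
Proof.
replace z with (RtoC (Re z) + Ci * RtoC (Im z)) at 1.
2: { destruct z as [x y]. unfold Ci, RtoC, Cmult, Cplus. simpl. f_equal; ring. }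
eapply Rle_trans; [apply Cmod_triangle|].
rewrite Cmod_mult, !Cmod_R.
replace (Cmod Ci) with 1%R; [lra|].
unfold Cmod, Ci. simpl. replace (0 * (0 * 1) + 1 * (1 * 1))%R with 1%R by ring.
now rewrite sqrt_1.
Qed.

Lemma Im_le_Cmod (z : C) : (Rabs (Im z) <= Cmod z)%R.
Proof. eapply Rle_trans; [apply Rmax_r|apply Rmax_Cmod]. Qed.

Definition Csummable (u : nat -> C) : Prop := ex_series (fun n => Cmod (u n)).

(** Defined by components so that the total real [Series] and its lemmas apply; meaningful under
    [Csummable]. *)
Definition CSeries (u : nat -> C) : C :=
  (Series (fun n => Re (u n)), Series (fun n => Im (u n))).

Lemma Csummable_le (u : nat -> C) (v : nat -> R) :
  (forall n, (Cmod (u n) <= v n)%R) -> ex_series v -> Csummable u.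
Proof.
intros H Hv. unfold Csummable. apply (ex_series_le (K := R_AbsRing) (V := R_CompleteNormedModule)) with v; [|easy].
intros n. change (Rabs (Cmod (u n)) <= v n)%R. rewrite Rabs_right; [easy|].
apply Rle_ge, Cmod_ge_0.
Qed.

Lemma Csummable_Re (u : nat -> C) : Csummable u -> ex_series (fun n => Re (u n)).
Proof.
intros H. apply (ex_series_le (K := R_AbsRing) (V := R_CompleteNormedModule)) with (fun n => Cmod (u n)); [|easy].
intros n. apply re_le_Cmod.
Qed.

Lemma Csummable_Im (u : nat -> C) : Csummable u -> ex_series (fun n => Im (u n)).
Proof.
intros H. apply (ex_series_le (K := R_AbsRing) (V := R_CompleteNormedModule)) with (fun n => Cmod (u n)); [|easy].
intros n. apply Im_le_Cmod.
Qed.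

Lemma Csummable_plus (u v : nat -> C) :
  Csummable u -> Csummable v -> Csummable (fun n => u n + v n).
Proof.
intros Hu Hv. apply Csummable_le with (fun n => (Cmod (u n) + Cmod (v n))%R).
- intros n. apply Cmod_triangle.
- now apply (ex_series_plus (V := R_NormedModule)).
Qed.

Lemma Csummable_scal (c : C) (u : nat -> C) :
  Csummable u -> Csummable (fun n => c * u n).
Proof.
intros Hu. apply Csummable_le with (fun n => (Cmod c * Cmod (u n))%R).
- intros n. rewrite Cmod_mult. lra.
- now apply (ex_series_scal (V := R_NormedModule)).
Qed.

Lemma CSeries_ext (u v : nat -> C) : (forall n, u n = v n) -> CSeries u = CSeries v.
Proof.
intros H. unfold CSeries. f_equal; apply Series_ext; intros n; now rewrite H.
Qed.

Lemma CSeries_plus (u v : nat -> C) : Csummable u -> Csummable v ->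
  CSeries (fun n => u n + v n) = CSeries u + CSeries v.
Proof.
intros Hu Hv. apply injective_projections; simpl.
- rewrite <- Series_plus by now apply Csummable_Re. now apply Series_ext.
- rewrite <- Series_plus by now apply Csummable_Im. now apply Series_ext.
Qed.

Lemma CSeries_scal (c : C) (u : nat -> C) : Csummable u ->
  CSeries (fun n => c * u n) = c * CSeries u.
Proof.
intros Hu.
assert (H1 := Csummable_Re _ Hu). assert (H2 := Csummable_Im _ Hu).
apply injective_projections; simpl; rewrite <- !Series_scal_l.
- rewrite <- Series_minus; [now apply Series_ext| |];
  now apply (ex_series_scal (V := R_NormedModule)).
- rewrite <- Series_plus; [now apply Series_ext| |];
  now apply (ex_series_scal (V := R_NormedModule)).
Qed.

Lemma CSeries_incr_1 (u : nat -> C) : Csummable u ->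
  CSeries u = u O + CSeries (fun n => u (S n)).
Proof.
intros Hu. apply injective_projections; simpl.
- rewrite (Series_incr_1 (fun n => Re (u n))) by now apply Csummable_Re. easy.
- rewrite (Series_incr_1 (fun n => Im (u n))) by now apply Csummable_Im. easy.
Qed.

(** The factor 2 comes from bounding real and imaginary parts separately. *)
Lemma Cmod_CSeries_le (u : nat -> C) (v : nat -> R) :
  (forall n, (Cmod (u n) <= v n)%R) -> ex_series v ->
  (Cmod (CSeries u) <= 2 * Series v)%R.
Proof.
intros H Hv.
assert (Hu := Csummable_le _ _ H Hv).
assert (K : forall f : nat -> R, (forall n, Rabs (f n) <= v n)%R -> (Rabs (Series f) <= Series v)%R).
{ intros f Hf.
  assert (Hf' : ex_series (fun n => Rabs (f n))).
  { apply (ex_series_le (K := R_AbsRing) (V := R_CompleteNormedModule)) with v; [|easy].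
    intros n. change (Rabs (Rabs (f n)) <= v n)%R. now rewrite Rabs_Rabsolu. }
  eapply Rle_trans; [now apply Series_Rabs|]. apply Series_le; [|easy].
  intros n. split; [apply Rabs_pos|apply Hf]. }
eapply Rle_trans; [apply Cmod_le_Rabs|].
assert (K1 := K (fun n => Re (u n))). assert (K2 := K (fun n => Im (u n))).
simpl.
assert (forall n, Rabs (Re (u n)) <= v n)%R.
{ intros n. eapply Rle_trans; [apply re_le_Cmod|apply H]. }
assert (forall n, Rabs (Im (u n)) <= v n)%R.
{ intros n. eapply Rle_trans; [apply Im_le_Cmod|apply H]. }
specialize (K1 H0). specialize (K2 H1). lra.
Qed.

(** Bernoulli's inequality for (1 + t)^n with 1 + t = 1 / q gives n t <= q^(-n), that is, n q^n <= 1
    / t. *)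
Lemma linear_mult_pow_bounded (q : R) : (0 < q < 1)%R ->
  exists K : R, forall n : nat, (INR (S n) * q ^ n <= K)%R.
Proof.
intros [Hq Hq1]. set (t := (/ q - 1)%R).
assert (Ht : (0 < t)%R).
{ unfold t. assert (1 < / q)%R by (rewrite <- Rinv_1; apply Rinv_lt_contravar; lra). lra. }
exists (1 + / t)%R. intros n.
assert (P := poly n t Ht).
replace (1 + t)%R with (/ q)%R in P by (unfold t; ring).
rewrite pow_inv in P.
assert (Hqn := pow_lt q n Hq).
assert (H1 : ((1 + INR n * t) * q ^ n <= 1)%R).
{ apply Rle_trans with (/ q ^ n * q ^ n)%R; [apply Rmult_le_compat_r; lra|].
  rewrite Rinv_l; lra. }
rewrite S_INR.
assert (Hn := pos_INR n).
assert (H2 : (q ^ n <= 1)%R) by (rewrite <- (pow1 n); apply pow_incr; lra).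
assert (H3 : (INR n * q ^ n <= / t)%R).
{ apply Rmult_le_reg_l with t; [easy|]. rewrite Rinv_r; nra. }
lra.
Qed.

(** The cube serves the remainder of a power series: a monomial of degree n contributes n^2 and
    there are n + 1 of them. Writing q = s^4, three factors s^n absorb the cube and the fourth is a
    convergent geometric term. *)
Lemma ex_series_poly_geom (q : R) : (0 < q < 1)%R ->
  ex_series (fun n => (INR (S n) ^ 3 * q ^ n)%R).
Proof.
intros [Hq Hq1].
assert (A : forall x, (0 < x < 1)%R -> (0 < sqrt x < 1)%R).
{ intros x Hx. split; [apply sqrt_lt_R0; lra|]. rewrite <- sqrt_1. apply sqrt_lt_1; lra. }
set (s := sqrt (sqrt q)).
assert (Hs : (0 < s < 1)%R) by (apply A, A; lra).
assert (Es : (q = s ^ 4)%R).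
{ unfold s. replace (sqrt (sqrt q) ^ 4)%R with ((sqrt (sqrt q) * sqrt (sqrt q)) * (sqrt (sqrt q) * sqrt (sqrt q)))%R by ring.
  rewrite (sqrt_sqrt (sqrt q)) by apply sqrt_pos. now rewrite sqrt_sqrt by lra. }
destruct (linear_mult_pow_bounded s Hs) as [K HK].
apply (ex_series_le (K := R_AbsRing) (V := R_CompleteNormedModule)) with (fun n => (K ^ 3 * s ^ n)%R).
- intros n. change (Rabs (INR (S n) ^ 3 * q ^ n) <= K ^ 3 * s ^ n)%R.
  assert (H0 := pos_INR (S n)).
  assert (H1 := pow_lt s n (proj1 Hs)).
  rewrite Rabs_right.
  2: { apply Rle_ge, Rmult_le_pos; [now apply pow_le|apply pow_le; lra]. }
  rewrite Es, <- pow_mult, Nat.mul_comm, pow_mult.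
  replace (INR (S n) ^ 3 * (s ^ n) ^ 4)%R with ((INR (S n) * s ^ n) ^ 3 * s ^ n)%R by ring.
  apply Rmult_le_compat_r; [lra|]. apply pow_incr. split; [|apply HK].
  apply Rmult_le_pos; lra.
- apply (ex_series_scal (V := R_NormedModule)).
  exists (/ (1 - s))%R. apply is_series_geom. rewrite Rabs_right; lra.
Qed.

(** * Taylor estimates for powers *)

Lemma pow_increment_bound (x h : C) (r : R) (a : nat) :
  (Cmod x <= r)%R -> (Cmod (x + h) <= r)%R ->
  (Cmod ((x + h) ^ a - x ^ a)%C * r <= INR a * r ^ a * Cmod h)%R.
Proof.
intros Hx Hxh. assert (Hx0 := Cmod_ge_0 x). assert (Hh0 := Cmod_ge_0 h).
assert (Hr : (0 <= r)%R) by lra.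
induction a as [|a IH].
- simpl. replace (1 - 1) with (RtoC 0) by ring. rewrite Cmod_0. lra.
- rewrite !Cpow_S. rewrite S_INR.
  replace ((x + h) * (x + h) ^ a - x * x ^ a) with
   ((x + h) * ((x + h) ^ a - x ^ a) + h * x ^ a) by ring.
  assert (T := Cmod_triangle ((x + h) * ((x + h) ^ a - x ^ a)) (h * x ^ a)).
  rewrite !Cmod_mult, Cmod_pow in T.
  assert (P : (Cmod x ^ a <= r ^ a)%R) by (apply pow_incr; lra).
  set (D := Cmod ((x + h) ^ a - x ^ a)) in *.
  assert (HD : (0 <= D)%R) by apply Cmod_ge_0.
  assert (Hra := pow_le r a Hr).
  apply Rle_trans with ((Cmod (x + h)%C * D + Cmod h * Cmod x ^ a) * r)%R.
  { now apply Rmult_le_compat_r. }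
  apply Rle_trans with (r * (D * r) + Cmod h * r ^ a * r)%R.
  { assert (Cmod (x + h)%C * (D * r) <= r * (D * r))%R by (apply Rmult_le_compat_r; nra).
    assert (Cmod h * Cmod x ^ a * r <= Cmod h * r ^ a * r)%R.
    { apply Rmult_le_compat_r; [easy|]. apply Rmult_le_compat_l; easy. }
    lra. }
  apply Rle_trans with (r * (INR a * r ^ a * Cmod h) + Cmod h * r ^ a * r)%R.
  { apply Rplus_le_compat_r. apply Rmult_le_compat_l; easy. }
  simpl. apply Req_le. ring.
Qed.

Lemma pow_derivative_bound (x : C) (r : R) (a : nat) :
  (Cmod x <= r)%R -> (Cmod (RtoC (INR a) * x ^ pred a)%C * r <= INR a * r ^ a)%R.
Proof.
intros Hx. assert (Hx0 := Cmod_ge_0 x).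
rewrite Cmod_mult, Cmod_pow, Cmod_R, Rabs_right by apply Rle_ge, pos_INR.
destruct a as [|a]; [simpl; lra|].
simpl pred. rewrite Rmult_assoc. apply Rmult_le_compat_l; [apply pos_INR|].
simpl. rewrite Rmult_comm. apply Rmult_le_compat_l; [lra|]. apply pow_incr; lra.
Qed.

(** The remainder for a + 1 is x times the remainder for a, plus h times the increment of the a-th
    power; a^2 + a <= (a + 1)^2 closes the induction. Multiplying by r^2 on the left avoids the
    exponent a - 2 and any division by r. *)
Lemma pow_taylor_bound (x h : C) (r : R) (a : nat) :
  (Cmod x <= r)%R -> (Cmod (x + h) <= r)%R ->
  (Cmod ((x + h) ^ a - x ^ a - RtoC (INR a) * x ^ pred a * h)%C * (r * r) <=
    INR a * INR a * r ^ a * (Cmod h * Cmod h))%R.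
Proof.
intros Hx Hxh. assert (Hx0 := Cmod_ge_0 x). assert (Hh0 := Cmod_ge_0 h).
assert (Hr : (0 <= r)%R) by lra.
induction a as [|a IH].
- simpl. replace (1 - 1 - 0 * 1 * h) with (RtoC 0) by ring. rewrite Cmod_0. lra.
- assert (B := pow_increment_bound x h r a Hx Hxh).
  simpl pred. rewrite !Cpow_S.
  assert (E : RtoC (INR a) * x ^ a = x * (RtoC (INR a) * x ^ pred a)).
  { destruct a as [|a]; [simpl; ring|]. simpl pred. rewrite Cpow_S. ring. }
  rewrite S_INR, RtoC_plus.
  replace ((x + h) * (x + h) ^ a - x * x ^ a - (RtoC (INR a) + 1) * x ^ a * h) with
   (x * ((x + h) ^ a - x ^ a - RtoC (INR a) * x ^ pred a * h) + h * ((x + h) ^ a - x ^ a)).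
  2: { replace ((RtoC (INR a) + 1) * x ^ a * h) with (RtoC (INR a) * x ^ a * h + x ^ a * h) by ring. rewrite E. ring. }
  set (u := (x + h) ^ a - x ^ a) in *.
  set (v := u - RtoC (INR a) * x ^ pred a * h) in *.
  assert (T := Cmod_triangle (x * v) (h * u)).
  rewrite !Cmod_mult in T.
  assert (Hu := Cmod_ge_0 u). assert (Hv := Cmod_ge_0 v).
  assert (Hra := pow_le r a Hr). assert (Ha := pos_INR a).
  apply Rle_trans with ((Cmod x * Cmod v + Cmod h * Cmod u) * (r * r))%R.
  { apply Rmult_le_compat_r; [nra|easy]. }
  apply Rle_trans with (r * (Cmod v * (r * r)) + Cmod h * r * (Cmod u * r))%R.
  { assert (Cmod x * (Cmod v * (r * r)) <= r * (Cmod v * (r * r)))%R.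
    { apply Rmult_le_compat_r; [|easy]. apply Rmult_le_pos; nra. }
    lra. }
  apply Rle_trans with (r * (INR a * INR a * r ^ a * (Cmod h * Cmod h)) + Cmod h * r * (INR a * r ^ a * Cmod h))%R.
  { apply Rplus_le_compat; apply Rmult_le_compat_l; try easy. nra. }
  simpl.
  replace ((INR a + 1) * (INR a + 1) * (r * r ^ a) * (Cmod h * Cmod h))%R with
   (r * (INR a * INR a * r ^ a * (Cmod h * Cmod h)) + Cmod h * r * (INR a * r ^ a * Cmod h) + (INR a + 1) * (r * r ^ a * (Cmod h * Cmod h)))%R by ring.
  assert (0 <= (INR a + 1) * (r * r ^ a * (Cmod h * Cmod h)))%R; [|lra].
  apply Rmult_le_pos; [lra|]. apply Rmult_le_pos; nra.
Qed.

(** * Double power series *)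

(** Grouping by total degree makes a double power series a simple series of finite sums. *)
Definition dps_term (c : nat -> nat -> C) (x y : C) (n : nat) : C :=
  Csum (fun a => c a (n - a)%nat * (x ^ a * y ^ (n - a))) (S n).

Definition dps (c : nat -> nat -> C) (x y : C) : C := CSeries (dps_term c x y).

(** A bound for every radius below 1 amounts to convergence on the unit bidisc, and it survives
    termwise differentiation at the price of a slightly larger radius. *)
Definition dps_bounded (c : nat -> nat -> C) : Prop :=
  forall r : R, (0 < r < 1)%R -> exists M : R, (0 < M)%R /\
    forall a b : nat, (Cmod (c a b) * r ^ (a + b) <= M)%R.

Definition dps_dl (c : nat -> nat -> C) (a b : nat) : C := RtoC (INR (S a)) * c (S a) b.
Definition dps_dr (c : nat -> nat -> C) (a b : nat) : C := RtoC (INR (S b)) * c a (S b).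

(** Between a radius r and a larger s < 1 there is a gain of (r / s)^(a + b), which absorbs the new
    factor a + 1. *)
Lemma dps_bounded_dl (c : nat -> nat -> C) : dps_bounded c -> dps_bounded (dps_dl c).
Proof.
intros H r Hr.
set (s := ((1 + r) / 2)%R). assert (Hs : (0 < s < 1)%R) by (unfold s; lra).
destruct (H s Hs) as [M [HM HB]].
assert (Hq : (0 < r / s < 1)%R).
{ split; [apply Rdiv_lt_0_compat; lra|]. apply Rmult_lt_reg_r with s; [lra|].
  unfold Rdiv. rewrite Rmult_assoc, Rinv_l by lra. unfold s. lra. }
destruct (linear_mult_pow_bounded _ Hq) as [K HK].
assert (HK0 : (1 <= K)%R) by (specialize (HK O); simpl in HK; lra).
exists (K * (M / s))%R. split.
{ apply Rmult_lt_0_compat; [lra|]. apply Rdiv_lt_0_compat; lra. }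
intros a b. unfold dps_dl. rewrite Cmod_mult, Cmod_R, Rabs_right by apply Rle_ge, pos_INR.
assert (Hsn := pow_lt s (a + b) (proj1 Hs)).
assert (Hrn := pow_lt r (a + b) (proj1 Hr)).
replace (INR (S a) * Cmod (c (S a) b) * r ^ (a + b))%R with
 (INR (S a) * (r / s) ^ (a + b) * (Cmod (c (S a) b) * s ^ (S a + b) / s))%R.
2: { unfold Rdiv. rewrite Rpow_mult_distr, pow_inv. simpl. field. lra. }
assert (Hqn := pow_lt (r / s) (a + b) (proj1 Hq)).
apply Rmult_le_compat.
- apply Rmult_le_pos; [apply pos_INR|lra].
- apply Rmult_le_pos; [|apply Rlt_le, Rinv_0_lt_compat; lra].
  apply Rmult_le_pos; [apply Cmod_ge_0|apply pow_le; lra].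
- eapply Rle_trans; [|apply (HK (a + b)%nat)].
  apply Rmult_le_compat_r; [lra|]. apply le_INR. lia.
- apply Rmult_le_compat_r; [apply Rlt_le, Rinv_0_lt_compat; lra|]. apply HB.
Qed.

Lemma dps_bounded_dr (c : nat -> nat -> C) : dps_bounded c -> dps_bounded (dps_dr c).
Proof.
intros H.
assert (H' : dps_bounded (fun a b => c b a)).
{ intros r Hr. destruct (H r Hr) as [M [HM HB]]. exists M. split; [easy|].
  intros a b. rewrite Nat.add_comm. apply HB. }
intros r Hr. destruct (dps_bounded_dl _ H' r Hr) as [M [HM HB]]. exists M. split; [easy|].
intros a b. rewrite Nat.add_comm. apply HB.
Qed.

Lemma monomial_taylor_bound (x y h k : C) (r : R) (a b : nat) :
  (Cmod x <= r)%R -> (Cmod (x + h) <= r)%R -> (Cmod y <= r)%R -> (Cmod (y + k) <= r)%R ->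
  (Cmod ((x + h) ^ a * (y + k) ^ b - x ^ a * y ^ b
     - RtoC (INR a) * x ^ pred a * y ^ b * h - RtoC (INR b) * x ^ a * y ^ pred b * k)%C * (r * r)
   <= INR (a + b) ^ 2 * r ^ (a + b) * (Cmod h + Cmod k) ^ 2)%R.
Proof.
intros Hx Hxh Hy Hyk.
assert (Hx0 := Cmod_ge_0 x). assert (Hh := Cmod_ge_0 h). assert (Hk := Cmod_ge_0 k).
assert (Hr : (0 <= r)%R) by lra.
assert (Ta := pow_taylor_bound x h r a Hx Hxh).
assert (Tb := pow_taylor_bound y k r b Hy Hyk).
assert (Ib := pow_increment_bound y k r b Hy Hyk).
assert (Da := pow_derivative_bound x r a Hx).
assert (PX : (Cmod (x ^ a) <= r ^ a)%R).
{ rewrite Cmod_pow. apply pow_incr. lra. }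
assert (PY : (Cmod ((y + k) ^ b) <= r ^ b)%R).
{ rewrite Cmod_pow. apply pow_incr. split; [apply Cmod_ge_0|easy]. }
set (X1 := RtoC (INR a) * x ^ pred a) in *. set (Y1 := RtoC (INR b) * y ^ pred b) in *.
set (ta := (x + h) ^ a - x ^ a - X1 * h) in *.
set (tb := (y + k) ^ b - y ^ b - Y1 * k) in *.
set (ib := (y + k) ^ b - y ^ b) in *.
(* The variables are moved one after the other: remainder in x at the new y, the mixed term,
   remainder in y at the old x. These cost A^2 |h|^2, A B |h| |k| and B^2 |k|^2, all within ((A + B)
   (|h| + |k|))^2. *)
match goal with |- (Cmod ?t * _ <= _)%R => replace t with
  (ta * (y + k) ^ b + (X1 * h * ib + x ^ a * tb)) end.
2: { unfold ta, tb, ib, X1, Y1. ring. }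
assert (T1 := Cmod_triangle (ta * (y + k) ^ b) (X1 * h * ib + x ^ a * tb)).
assert (T2 := Cmod_triangle (X1 * h * ib) (x ^ a * tb)).
rewrite !Cmod_mult in T1. rewrite !Cmod_mult in T2.
set (A := INR a) in *. set (B := INR b) in *.
assert (HA : (0 <= A)%R) by apply pos_INR. assert (HB : (0 <= B)%R) by apply pos_INR.
assert (Hra := pow_le r a Hr). assert (Hrb := pow_le r b Hr).
rewrite plus_INR, pow_add. fold A B.
set (p := (r ^ a)%R) in *. set (q := (r ^ b)%R) in *.
assert (M1 : (Cmod ta * (r * r) * Cmod ((y + k) ^ b) <= (A * A * p * (Cmod h * Cmod h)) * q)%R).
{ apply Rmult_le_compat; try apply Cmod_ge_0; try easy. apply Rmult_le_pos; [apply Cmod_ge_0|nra]. }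
assert (M2 : (Cmod X1 * r * (Cmod ib * r) * Cmod h <= (A * p) * (B * q * Cmod k) * Cmod h)%R).
{ apply Rmult_le_compat_r; [easy|]. apply Rmult_le_compat; try easy; apply Rmult_le_pos; try apply Cmod_ge_0; easy. }
assert (M3 : (Cmod (x ^ a) * (Cmod tb * (r * r)) <= p * (B * B * q * (Cmod k * Cmod k)))%R).
{ apply Rmult_le_compat; try apply Cmod_ge_0; try easy. apply Rmult_le_pos; [apply Cmod_ge_0|nra]. }
eapply Rle_trans.
{ apply Rmult_le_compat_r; [nra|]. eapply Rle_trans; [apply T1|]. apply Rplus_le_compat_l, T2. }
eapply Rle_trans with (p * q * (A * A * (Cmod h * Cmod h) + A * B * (Cmod h * Cmod k) + B * B * (Cmod k * Cmod k)))%R.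
{ lra. }
replace ((A + B) ^ 2 * (p * q) * (Cmod h + Cmod k) ^ 2)%R with (p * q * ((A + B) * (Cmod h + Cmod k)) ^ 2)%R by ring.
apply Rmult_le_compat_l; [nra|].
replace (((A + B) * (Cmod h + Cmod k)) ^ 2)%R with ((A * Cmod h + A * Cmod k + B * Cmod h + B * Cmod k) ^ 2)%R by ring.
assert (0 <= A * Cmod h)%R by nra. assert (0 <= A * Cmod k)%R by nra.
assert (0 <= B * Cmod h)%R by nra. assert (0 <= B * Cmod k)%R by nra.
nra.
Qed.

Lemma Cmod_coef_le (c : nat -> nat -> C) (r s M : R) (a b : nat) :
  (0 < r)%R -> (0 < s)%R -> (Cmod (c a b) * s ^ (a + b) <= M)%R ->
  (Cmod (c a b) * r ^ (a + b) <= M * (r / s) ^ (a + b))%R.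
Proof.
intros Hr Hs H. assert (Hsn := pow_lt s (a + b) Hs).
replace (Cmod (c a b) * r ^ (a + b))%R with ((Cmod (c a b) * s ^ (a + b)) * (r / s) ^ (a + b))%R.
2: { unfold Rdiv. rewrite Rpow_mult_distr, pow_inv. field. lra. }
apply Rmult_le_compat_r; [|easy]. apply pow_le. apply Rlt_le, Rdiv_lt_0_compat; easy.
Qed.

Lemma dps_summable (c : nat -> nat -> C) (x y : C) :
  dps_bounded c -> (Cmod x < 1)%R -> (Cmod y < 1)%R -> Csummable (dps_term c x y).
Proof.
intros H Hx Hy. assert (Hx0 := Cmod_ge_0 x). assert (Hy0 := Cmod_ge_0 y).
set (r := ((1 + Rmax (Cmod x) (Cmod y)) / 2)%R). set (s := ((1 + r) / 2)%R).
assert (Hxm := Rmax_l (Cmod x) (Cmod y)). assert (Hym := Rmax_r (Cmod x) (Cmod y)).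
assert (Hm : (Rmax (Cmod x) (Cmod y) < 1)%R) by now apply Rmax_lub_lt.
assert (Hr : (0 < r < s)%R) by (unfold s, r; lra).
assert (Hs : (0 < s < 1)%R) by (unfold s, r; lra).
assert (Hxr : (Cmod x <= r)%R) by (unfold r; lra).
assert (Hyr : (Cmod y <= r)%R) by (unfold r; lra).
destruct (H s Hs) as [M [HM HB]].
assert (Hq : (0 < r / s < 1)%R).
{ split; [apply Rdiv_lt_0_compat; lra|]. apply Rmult_lt_reg_r with s; [lra|].
  unfold Rdiv. rewrite Rmult_assoc, Rinv_l by lra. lra. }
(* The layer of degree n has n + 1 monomials, each at most M (r / s)^n; the cube is a generous bound
   for n + 1. *)
apply Csummable_le with (fun n => M * (INR (S n) ^ 3 * (r / s) ^ n))%R.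
2: { apply (ex_series_scal (V := R_NormedModule)). now apply ex_series_poly_geom. }
intros n. eapply Rle_trans.
- apply (Cmod_Csum_le _ _ (M * (r / s) ^ n)%R). intros a Ha.
  replace (M * (r / s) ^ n)%R with (M * (r / s) ^ (a + (n - a)))%R by (do 2 f_equal; lia). set (b := (n - a)%nat).
  rewrite !Cmod_mult, !Cmod_pow.
  eapply Rle_trans; [|apply (Cmod_coef_le c r s M a b); [easy|easy|apply HB]].
  apply Rmult_le_compat_l; [apply Cmod_ge_0|]. rewrite pow_add.
  apply Rmult_le_compat; try (apply pow_le; easy); apply pow_incr; easy.
- assert (Hn : (1 <= INR (S n))%R) by (rewrite S_INR; assert (T := pos_INR n); lra).
  assert (Hqn := pow_lt _ n (proj1 Hq)).
  replace (INR (S n) * (M * (r / s) ^ n))%R with (M * (INR (S n) * (r / s) ^ n))%R by ring.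
  apply Rmult_le_compat_l; [lra|]. apply Rmult_le_compat_r; [lra|].
  set (N := INR (S n)) in *. clearbody N.
  assert (1 <= N * N)%R by nra. replace (N ^ 3)%R with (N * (N * N))%R by ring. nra.
Qed.

(** Puts the remainder of a termwise differentiated series under one summation sign, where it can be
    estimated term by term. *)
Lemma CSeries_remainder (u v t1 t2 : nat -> C) (h k : C) :
  Csummable u -> Csummable v -> Csummable t1 -> Csummable t2 ->
  CSeries (fun n => u n + ((-(1)) * v n + ((-h) * t1 n + (-k) * t2 n))) =
  CSeries u - CSeries v - (CSeries t1 * h + CSeries t2 * k).
Proof.
intros Hu Hv H1 H2.
assert (Hv' := Csummable_scal (-(1)) v Hv).
assert (H1' := Csummable_scal (-h) t1 H1).
assert (H2' := Csummable_scal (-k) t2 H2).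
assert (H3 := Csummable_plus _ _ H1' H2').
assert (H4 := Csummable_plus _ _ Hv' H3).
rewrite (CSeries_plus u _ Hu H4), (CSeries_plus _ _ Hv' H3), (CSeries_plus _ _ H1' H2').
rewrite !CSeries_scal by assumption. ring.
Qed.

Lemma cdiff2_dps (c : nat -> nat -> C) (x y : C) :
  dps_bounded c -> (Cmod x < 1)%R -> (Cmod y < 1)%R ->
  cdiff2 (dps c) x y (dps (dps_dl c) x y) (dps (dps_dr c) x y).
Proof.
intros H Hx Hy. assert (Hx0 := Cmod_ge_0 x). assert (Hy0 := Cmod_ge_0 y).
(* Termwise partials kept at the index of the term they come from: their layer of degree n - 1 has
   index n, which lines them up with [dps_term c]. At exponent 0 the value of [pred] is harmless,
   its coefficient being 0. *)
set (T1 := fun n => Csum (fun a => c a (n - a)%nat * (RtoC (INR a) * x ^ pred a * y ^ (n - a))) (S n)).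
set (T2 := fun n => Csum (fun a => c a (n - a)%nat * (RtoC (INR (n - a)) * x ^ a * y ^ pred (n - a))) (S n)).
assert (E1 : forall n, T1 (S n) = dps_term (dps_dl c) x y n).
{ intros n. unfold T1. rewrite Csum_first. unfold dps_term.
  replace (c O (S n - 0)%nat * (RtoC (INR 0) * x ^ pred 0 * y ^ (S n - 0))) with (RtoC 0) by (simpl; ring).
  rewrite Cplus_0_l. apply Csum_ext. intros i Hi. unfold dps_dl. simpl pred. simpl Nat.sub. ring. }
assert (E2 : forall n, T2 (S n) = dps_term (dps_dr c) x y n).
{ intros n. unfold T2.
  change (Csum (fun a => c a (S n - a)%nat * (RtoC (INR (S n - a)) * x ^ a * y ^ pred (S n - a))) (S n)
    + c (S n) (S n - S n)%nat * (RtoC (INR (S n - S n)) * x ^ (S n) * y ^ pred (S n - S n)) = dps_term (dps_dr c) x y n).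
  rewrite Nat.sub_diag. simpl (INR 0).
  match goal with |- _ + ?t = _ => replace t with (RtoC 0) by ring end.
  rewrite Cplus_0_r. apply Csum_ext. intros i Hi. unfold dps_dr.
  replace (S n - i)%nat with (S (n - i)) by lia. simpl pred. ring. }
assert (Z1 : T1 O = 0) by (unfold T1; simpl; ring).
assert (Z2 : T2 O = 0) by (unfold T2; simpl; ring).
assert (S1 : Csummable T1).
{ apply (ex_series_incr_1 (fun n => Cmod (T1 n))).
  eapply ex_series_ext; [|apply (dps_summable _ x y (dps_bounded_dl _ H) Hx Hy)].
  intros n. simpl. now rewrite E1. }
assert (S2 : Csummable T2).
{ apply (ex_series_incr_1 (fun n => Cmod (T2 n))).
  eapply ex_series_ext; [|apply (dps_summable _ x y (dps_bounded_dr _ H) Hx Hy)].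
  intros n. simpl. now rewrite E2. }
assert (D1 : dps (dps_dl c) x y = CSeries T1).
{ rewrite (CSeries_incr_1 T1), Z1, Cplus_0_l by easy. apply CSeries_ext. intros n. now rewrite E1. }
assert (D2 : dps (dps_dr c) x y = CSeries T2).
{ rewrite (CSeries_incr_1 T2), Z2, Cplus_0_l by easy. apply CSeries_ext. intros n. now rewrite E2. }
rewrite D1, D2. clear D1 D2 E1 E2 Z1 Z2.
set (m := Rmax (Cmod x) (Cmod y)).
set (r := ((1 + m) / 2)%R). set (s := ((1 + r) / 2)%R).
assert (Hxm := Rmax_l (Cmod x) (Cmod y)). assert (Hym := Rmax_r (Cmod x) (Cmod y)).
assert (Hm : (m < 1)%R) by now apply Rmax_lub_lt. fold m in Hxm, Hym.
assert (Hr : (0 < r < s)%R) by (unfold s, r; lra).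
assert (Hs : (0 < s < 1)%R) by (unfold s, r; lra).
destruct (H s Hs) as [M [HM HB]].
assert (Hq : (0 < r / s < 1)%R).
{ split; [apply Rdiv_lt_0_compat; lra|]. apply Rmult_lt_reg_r with s; [lra|].
  unfold Rdiv. rewrite Rmult_assoc, Rinv_l by lra. lra. }
set (q := (r / s)%R) in *.
assert (HV := ex_series_poly_geom q Hq).
set (V := Series (fun n => (INR (S n) ^ 3 * q ^ n)%R)).
assert (HV0 : (0 <= V)%R).
{ rewrite <- (Rmult_0_l V). unfold V. rewrite <- Series_scal_l. apply Series_le; [|easy].
  intros n. rewrite Rmult_0_l. split; [lra|]. apply Rmult_le_pos; [apply pow_le, pos_INR|apply pow_le; lra]. }
(* The remainder will be at most W (|h| + |k|)^2: the 2 is that of [Cmod_CSeries_le], and r^2 is the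
   factor of [monomial_taylor_bound]. *)
set (W := (2 * (M / (r * r) * V))%R).
assert (HMr : (0 < M / (r * r))%R) by (apply Rdiv_lt_0_compat; nra).
assert (HW : (0 <= W)%R) by (unfold W; nra).
(* Since m + (1 - m) / 2 = r, the first bound keeps the moved points within radius r. The second
   gives |h| + |k| <= eps / (W + 1), with W + 1 because W may be 0. *)
intros eps Heps. exists (Rmin ((1 - m) / 2) (eps / (2 * (W + 1)))). split.
{ apply Rmin_glb_lt; [lra|]. apply Rdiv_lt_0_compat; lra. }
intros h k Hh Hk.
assert (Hh1 := Rlt_le_trans _ _ _ Hh (Rmin_l _ _)).
assert (Hh2 := Rlt_le_trans _ _ _ Hh (Rmin_r _ _)).
assert (Hk1 := Rlt_le_trans _ _ _ Hk (Rmin_l _ _)).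
assert (Hk2 := Rlt_le_trans _ _ _ Hk (Rmin_r _ _)). clear Hh Hk.
assert (Hh0 := Cmod_ge_0 h). assert (Hk0 := Cmod_ge_0 k).
assert (Hxr : (Cmod x <= r)%R) by (unfold r; lra).
assert (Hyr : (Cmod y <= r)%R) by (unfold r; lra).
assert (Hxhr : (Cmod (x + h) <= r)%R) by (eapply Rle_trans; [apply Cmod_triangle|unfold r; lra]).
assert (Hykr : (Cmod (y + k) <= r)%R) by (eapply Rle_trans; [apply Cmod_triangle|unfold r; lra]).
assert (S3 : Csummable (dps_term c x y)) by now apply dps_summable.
assert (S4 : Csummable (dps_term c (x + h) (y + k))).
{ apply dps_summable; [easy| |]; unfold s in *; lra. }
unfold dps. rewrite <- (CSeries_remainder _ _ _ _ h k S4 S3 S1 S2).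
eapply Rle_trans.
{ apply (Cmod_CSeries_le _ (fun n => M / (r * r) * (Cmod h + Cmod k) ^ 2 * (INR (S n) ^ 3 * q ^ n))%R).
  2: { now apply (ex_series_scal (V := R_NormedModule)). }
  intros n. unfold dps_term, T1, T2. rewrite <- !Csum_scal, <- !Csum_plus.
  eapply Rle_trans.
  { apply (Cmod_Csum_le _ _ (M / (r * r) * (Cmod h + Cmod k) ^ 2 * (INR (S n) ^ 2 * q ^ n))%R).
    intros a Ha. set (b := (n - a)%nat).
    match goal with |- (Cmod ?t <= _)%R => replace t with (c a b * ((x + h) ^ a * (y + k) ^ b - x ^ a * y ^ b
     - RtoC (INR a) * x ^ pred a * y ^ b * h - RtoC (INR b) * x ^ a * y ^ pred b * k)) by ring end.
    rewrite Cmod_mult.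
    assert (B := monomial_taylor_bound x y h k r a b Hxr Hxhr Hyr Hykr).
    assert (Bc := Cmod_coef_le c r s M a b (proj1 Hr) (proj1 Hs) (HB a b)). fold q in Bc.
    assert (En : (a + b)%nat = n) by (unfold b; lia). rewrite En in B, Bc. clearbody b.
    match goal with |- (_ * Cmod ?t <= _)%R => set (tt := Cmod t) in * end.
    apply Rmult_le_reg_r with (r * r)%R; [nra|].
    replace (M / (r * r) * (Cmod h + Cmod k) ^ 2 * (INR (S n) ^ 2 * q ^ n) * (r * r))%R with
      (M * q ^ n * (INR (S n) ^ 2 * (Cmod h + Cmod k) ^ 2))%R by (field; lra).
    rewrite Rmult_assoc.
    apply Rle_trans with (Cmod (c a b) * (INR n ^ 2 * r ^ n * (Cmod h + Cmod k) ^ 2))%R.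
    { apply Rmult_le_compat_l; [apply Cmod_ge_0|easy]. }
    replace (Cmod (c a b) * (INR n ^ 2 * r ^ n * (Cmod h + Cmod k) ^ 2))%R with
     ((Cmod (c a b) * r ^ n) * (INR n ^ 2 * (Cmod h + Cmod k) ^ 2))%R by ring.
    apply Rmult_le_compat; try easy.
    - apply Rmult_le_pos; [apply Cmod_ge_0|apply pow_le; lra].
    - apply Rmult_le_pos; apply pow2_ge_0.
    - apply Rmult_le_compat_r; [apply pow2_ge_0|]. apply pow_incr. split; [apply pos_INR|].
      apply le_INR; lia. }
  apply Req_le. ring. }
rewrite Series_scal_l. fold V.
set (t := (Cmod h + Cmod k)%R) in *.
replace (2 * (M / (r * r) * t ^ 2 * V))%R with (W * t * t)%R by (unfold W; ring).
apply Rmult_le_compat_r; [unfold t; lra|].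
assert (Ht : (t <= eps / (W + 1))%R).
{ replace (eps / (W + 1))%R with (2 * (eps / (2 * (W + 1))))%R by (field; lra). unfold t; lra. }
apply Rle_trans with ((W + 1) * (eps / (W + 1)))%R.
- apply Rmult_le_compat; try easy; unfold t; lra.
- apply Req_le. field. lra.
Qed.

(** * Formal partial derivatives of a logarithm *)

Lemma Cexp_plus (p q : C) : Cexp (p + q) = Cexp p * Cexp q.
Proof.
unfold Cexp, Cmult. destruct p as [a b], q as [c d]. simpl.
rewrite exp_plus, cos_plus, sin_plus. f_equal; ring.
Qed.

Lemma Cexp_neq_0 (p : C) : Cexp p <> 0.
Proof.
intros H. assert (E := Cexp_plus p (- p)). rewrite H, Cplus_opp_r, Cmult_0_l in E.
unfold Cexp in E. simpl in E. rewrite exp_0, cos_0 in E. injection E. intros. lra.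
Qed.

Lemma derivable_pt_lim_0_remainder (f : R -> R) (l : R) :
  derivable_pt_lim f 0 l -> forall eps : R, (0 < eps)%R ->
  exists delta : R, (0 < delta)%R /\
    forall h : R, (Rabs h < delta)%R -> (Rabs (f h - f 0 - l * h) <= eps * Rabs h)%R.
Proof.
intros H eps He. destruct (H eps He) as [d Hd]. exists d. split; [apply cond_pos|].
intros h Hh. destruct (Req_dec h 0) as [->|Hh0].
- rewrite Rminus_diag, Rmult_0_r, Rminus_0_r, Rabs_R0. lra.
- specialize (Hd h Hh0 Hh). rewrite Rplus_0_l in Hd.
  replace (f h - f 0 - l * h)%R with (((f h - f 0) / h - l) * h)%R by (field; easy).
  rewrite Rabs_mult. apply Rmult_le_compat_r; [apply Rabs_pos|lra].
Qed.

(** Additivity reduces the claim to the remainder Cexp h - 1 - h at 0, which splits into the real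
    remainders of exp, cos and sin. *)
Lemma cdiff2_Cexp (p q : C) : cdiff2 (fun x _ => Cexp x) p q (Cexp p) 0.
Proof.
intros eps Heps.
set (N := Cmod (Cexp p)). assert (HN : (0 <= N)%R) by apply Cmod_ge_0.
(* The real and imaginary parts below cost 3 e |h| each, hence the 6. The bound 1/2, with |h| < e /
   2, ensures |1 + x| <= 2 and |exp x - 1| <= e. *)
set (e := Rmin (1 / 2) (eps / (6 * (N + 1)))).
assert (He : (0 < e)%R) by (apply Rmin_glb_lt; [lra|apply Rdiv_lt_0_compat; lra]).
assert (He1 : (e <= 1 / 2)%R) by apply Rmin_l.
assert (He2 : (6 * (N + 1) * e <= eps)%R).
{ apply Rle_trans with (6 * (N + 1) * (eps / (6 * (N + 1))))%R.
  - apply Rmult_le_compat_l; [lra|apply Rmin_r].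
  - apply Req_le. field. lra. }
destruct (derivable_pt_lim_0_remainder exp 1 derivable_pt_lim_exp_0 e He) as [d1 [Hd1 R1]].
destruct (derivable_pt_lim_0_remainder cos 0) with e as [d2 [Hd2 R2]]; [|easy|].
{ replace 0%R with (- sin 0)%R by (rewrite sin_0; lra). rewrite sin_0. replace (-0)%R with 0%R by lra.
  assert (T := derivable_pt_lim_cos 0). rewrite sin_0, Ropp_0 in T. exact T. }
destruct (derivable_pt_lim_0_remainder sin 1) with e as [d3 [Hd3 R3]]; [|easy|].
{ assert (T := derivable_pt_lim_sin 0). rewrite cos_0 in T. exact T. }
exists (Rmin (Rmin d1 d2) (Rmin d3 (e / 2))). split; [repeat apply Rmin_glb_lt; lra|].
intros h k Hh _.
assert (Hh' : (Cmod h < d1 /\ Cmod h < d2 /\ Cmod h < d3 /\ Cmod h < e / 2)%R).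
{ revert Hh. unfold Rmin. repeat destruct Rle_dec; intros; lra. }
destruct Hh' as [h1 [h2 [h3 h4]]].
rewrite Cexp_plus.
replace (Cexp p * Cexp h - Cexp p - (Cexp p * h + 0 * k)) with (Cexp p * (Cexp h - 1 - h)) by ring.
rewrite Cmod_mult. fold N.
assert (HB : (Cmod (Cexp h - 1 - h) <= 6 * e * Cmod h)%R).
{ destruct h as [x y].
  assert (Hx : (Rabs x <= Cmod (x, y))%R) by apply (re_le_Cmod (x, y)).
  assert (Hy : (Rabs y <= Cmod (x, y))%R) by apply (Im_le_Cmod (x, y)).
  set (t := Cmod (x, y)) in *.
  assert (Q1 := R1 x ltac:(lra)). assert (Q2 := R2 y ltac:(lra)). assert (Q3 := R3 y ltac:(lra)).
  rewrite exp_0 in Q1. rewrite cos_0 in Q2. rewrite sin_0 in Q3.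
  rewrite Rmult_1_l in Q1, Q3. rewrite Rmult_0_l, Rminus_0_r in Q2. rewrite Rminus_0_r in Q3.
  eapply Rle_trans; [apply Cmod_le_Rabs|]. simpl.
  replace (exp x * cos y + - (1) + - x)%R with ((exp x - 1 - x) * cos y + (1 + x) * (cos y - 1))%R by ring.
  replace (exp x * sin y + - 0 + - y)%R with ((exp x - 1) * sin y + (sin y - y))%R by ring.
  assert (Hx0 := Rabs_pos x). assert (Hy0 := Rabs_pos y).
  assert (C1 : (Rabs (cos y) <= 1)%R) by (apply Rabs_le, COS_bound).
  assert (A1 : (Rabs ((exp x - 1 - x) * cos y) <= e * Rabs x)%R).
  { rewrite Rabs_mult. assert (T := Rabs_pos (exp x - 1 - x)). nra. }
  assert (A2 : (Rabs ((1 + x) * (cos y - 1)) <= 2 * (e * Rabs y))%R).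
  { rewrite Rabs_mult. assert (T := Rabs_triang 1 x). rewrite Rabs_R1 in T.
    apply Rmult_le_compat; try apply Rabs_pos; lra. }
  assert (A3 : (Rabs (exp x - 1) <= e)%R).
  { replace (exp x - 1)%R with ((exp x - 1 - x) + x)%R by ring.
    eapply Rle_trans; [apply Rabs_triang|]. nra. }
  assert (A4 : (Rabs (sin y) <= 2 * Rabs y)%R).
  { replace (sin y) with ((sin y - y) + y)%R by ring.
    eapply Rle_trans; [apply Rabs_triang|]. nra. }
  assert (A5 : (Rabs ((exp x - 1) * sin y) <= e * (2 * Rabs y))%R).
  { rewrite Rabs_mult. apply Rmult_le_compat; try apply Rabs_pos; easy. }
  assert (T1 := Rabs_triang ((exp x - 1 - x) * cos y) ((1 + x) * (cos y - 1))).
  assert (T2 := Rabs_triang ((exp x - 1) * sin y) (sin y - y)).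
  nra. }
assert (Hk0 := Cmod_ge_0 k). assert (Hh0 := Cmod_ge_0 h).
apply Rle_trans with (N * (6 * e * Cmod h))%R; [now apply Rmult_le_compat_l|].
apply Rle_trans with (eps * Cmod h)%R; [|apply Rmult_le_compat_l; lra].
replace (N * (6 * e * Cmod h))%R with (6 * N * e * Cmod h)%R by ring.
apply Rmult_le_compat_r; [easy|]. nra.
Qed.

(* Syntax for functions of (z, w), closed under formal partial derivatives and
   containing [Q] (as [ELog]): commutation of partials becomes a structural
   induction. *)
Inductive expr : Type :=
| ECst (c : C) | EX | EY | EDps (c : nat -> nat -> C) | EInv | ELog
| EAdd (e1 e2 : expr) | EMul (e1 e2 : expr).

(** The difference quotient in a form that is regular on the diagonal, without the case split of
    [diff_quot]. *)
Definition quot_series (c : nat -> nat -> C) (z w : C) : C :=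
  1 + (-(1)) * (/ z * (/ w * dps c (/ z) (/ w))).

Fixpoint eval (c0 : nat -> nat -> C) (Q : C -> C -> C) (e : expr) (z w : C) : C :=
  match e with
  | ECst c => c
  | EX => / z
  | EY => / w
  | EDps c => dps c (/ z) (/ w)
  | EInv => / quot_series c0 z w
  | ELog => Q z w
  | EAdd e1 e2 => eval c0 Q e1 z w + eval c0 Q e2 z w
  | EMul e1 e2 => eval c0 Q e1 z w * eval c0 Q e2 z w
  end.

Definition EOpp (e : expr) : expr := EMul (ECst (-(1))) e.

(** Differentiation in z is -x^2 d/dx for x = 1/z; applied to 1 - x y F it gives x^2 y (F + x
    F_x). *)
Definition quot_dl (c0 : nat -> nat -> C) : expr :=
  EMul (EMul EX (EMul EX EY)) (EAdd (EDps c0) (EMul EX (EDps (dps_dl c0)))).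

Definition quot_dr (c0 : nat -> nat -> C) : expr :=
  EMul (EMul EY (EMul EX EY)) (EAdd (EDps c0) (EMul EY (EDps (dps_dr c0)))).

(** On [ELog] this is the logarithmic derivative, so [ELog] disappears after one step. *)
Fixpoint dl (c0 : nat -> nat -> C) (e : expr) : expr :=
  match e with
  | ECst _ => ECst 0
  | EX => EOpp (EMul EX EX)
  | EY => ECst 0
  | EDps c => EMul (EOpp (EMul EX EX)) (EDps (dps_dl c))
  | EInv => EOpp (EMul (EMul EInv EInv) (quot_dl c0))
  | ELog => EMul EInv (quot_dl c0)
  | EAdd e1 e2 => EAdd (dl c0 e1) (dl c0 e2)
  | EMul e1 e2 => EAdd (EMul (dl c0 e1) e2) (EMul e1 (dl c0 e2))
  end.

Fixpoint dr (c0 : nat -> nat -> C) (e : expr) : expr :=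
  match e with
  | ECst _ => ECst 0
  | EX => ECst 0
  | EY => EOpp (EMul EY EY)
  | EDps c => EMul (EOpp (EMul EY EY)) (EDps (dps_dr c))
  | EInv => EOpp (EMul (EMul EInv EInv) (quot_dr c0))
  | ELog => EMul EInv (quot_dr c0)
  | EAdd e1 e2 => EAdd (dr c0 e1) (dr c0 e2)
  | EMul e1 e2 => EAdd (EMul (dr c0 e1) e2) (EMul e1 (dr c0 e2))
  end.

Fixpoint wf (e : expr) : Prop :=
  match e with
  | EDps c => dps_bounded c
  | EAdd e1 e2 => wf e1 /\ wf e2
  | EMul e1 e2 => wf e1 /\ wf e2
  | _ => True
  end.

Lemma wf_dl (c0 : nat -> nat -> C) (e : expr) : dps_bounded c0 -> wf e -> wf (dl c0 e).
Proof.
intros H0. assert (H1 := dps_bounded_dl _ H0).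
induction e; simpl; try tauto. intros H. assert (H2 := dps_bounded_dl _ H). tauto.
Qed.

Lemma wf_dr (c0 : nat -> nat -> C) (e : expr) : dps_bounded c0 -> wf e -> wf (dr c0 e).
Proof.
intros H0. assert (H1 := dps_bounded_dr _ H0).
induction e; simpl; try tauto. intros H. assert (H2 := dps_bounded_dr _ H). tauto.
Qed.

Lemma wf_iter_dl (c0 : nat -> nat -> C) (e : expr) (n : nat) :
  dps_bounded c0 -> wf e -> wf (Nat.iter n (dl c0) e).
Proof. intros H0 H. induction n; simpl; [easy|]. now apply wf_dl. Qed.

Lemma wf_iter_dr (c0 : nat -> nat -> C) (e : expr) (n : nat) :
  dps_bounded c0 -> wf e -> wf (Nat.iter n (dr c0) e).
Proof. intros H0 H. induction n; simpl; [easy|]. now apply wf_dr. Qed.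

Lemma dps_dl_dr (c : nat -> nat -> C) (x y : C) :
  dps (dps_dl (dps_dr c)) x y = dps (dps_dr (dps_dl c)) x y.
Proof.
apply CSeries_ext. intros n. apply Csum_ext. intros i _. unfold dps_dl, dps_dr. ring.
Qed.

(** A purely algebraic identity, valid without convergence or any link between [Q] and [c0]. The two
    expressions differ as syntax, so only their values are compared. *)
Lemma eval_dl_dr (c0 : nat -> nat -> C) (Q : C -> C -> C) (e : expr) (z w : C) :
  eval c0 Q (dl c0 (dr c0 e)) z w = eval c0 Q (dr c0 (dl c0 e)) z w.
Proof.
induction e; simpl; try (rewrite dps_dl_dr); try ring.
- now rewrite IHe1, IHe2.
- rewrite IHe1, IHe2. ring.
Qed.

(** * Formal derivatives are true derivatives *)

Lemma De_neq_0 (z : C) : De z -> z <> 0.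
Proof. intros H. apply Cmod_gt_0. unfold De in H. lra. Qed.

Lemma De_inv (z : C) : De z -> (Cmod (/ z) < 1)%R.
Proof.
intros H. rewrite Cmod_inv by now apply De_neq_0. unfold De in H.
rewrite <- Rinv_1. apply Rinv_lt_contravar; lra.
Qed.

Lemma cdiff2_eq (F : C -> C -> C) (z w a b a' b' : C) :
  a = a' -> b = b' -> cdiff2 F z w a b -> cdiff2 F z w a' b'.
Proof. now intros -> ->. Qed.

Lemma cdiff2_unique (F : C -> C -> C) (z w a b a' b' : C) :
  cdiff2 F z w a b -> cdiff2 F z w a' b' -> a = a' /\ b = b'.
Proof.
intros H H'. split.
- rewrite <- (is_C_derive_unique _ _ _ (cdiff2_is_derive_l _ _ _ _ _ H)).
  exact (is_C_derive_unique _ _ _ (cdiff2_is_derive_l _ _ _ _ _ H')).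
- rewrite <- (is_C_derive_unique _ _ _ (cdiff2_is_derive_r _ _ _ _ _ H)).
  exact (is_C_derive_unique _ _ _ (cdiff2_is_derive_r _ _ _ _ _ H')).
Qed.

Lemma De_open (z : C) : De z ->
  exists r : R, (0 < r)%R /\ forall h : C, (Cmod h < r)%R -> De (z + h).
Proof.
intros H. exists (Cmod z - 1)%R. unfold De in *. split; [lra|]. intros h Hh.
assert (T := Cmod_triangle (z + h) (- h)). rewrite Cmod_opp in T.
replace (z + h + - h) with z in T by ring. lra.
Qed.

Lemma cdiff2_ext_De (F G : C -> C -> C) (z w a b : C) :
  De z -> De w -> (forall u v, De u -> De v -> F u v = G u v) ->
  cdiff2 F z w a b -> cdiff2 G z w a b.
Proof.
intros Hz Hw E. destruct (De_open z Hz) as [r1 [Hr1 H1]]. destruct (De_open w Hw) as [r2 [Hr2 H2]].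
apply cdiff2_ext_loc with (Rmin r1 r2); [now apply Rmin_glb_lt|].
intros h k Hh Hk. assert (T1 := Rmin_l r1 r2). assert (T2 := Rmin_r r1 r2).
apply E; [apply H1|apply H2]; lra.
Qed.

Lemma cdiff2_inv_fst (z w : C) : De z -> cdiff2 (fun u _ => / u) z w (- (/ z * / z)) 0.
Proof.
intros Hz. apply (cdiff2_eq _ z w (- (/ z * / z * 1)) (- (/ z * / z * 0))); try ring.
apply (cdiff2_inv (fun u _ => u)); [now apply De_neq_0|apply cdiff2_fst].
Qed.

Lemma cdiff2_inv_snd (z w : C) : De w -> cdiff2 (fun _ v => / v) z w 0 (- (/ w * / w)).
Proof.
intros Hw. apply (cdiff2_eq _ z w (- (/ w * / w * 0)) (- (/ w * / w * 1))); try ring.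
apply (cdiff2_inv (fun _ v => v)); [now apply De_neq_0|apply cdiff2_snd].
Qed.

Lemma cdiff2_dps_inv (c : nat -> nat -> C) (z w : C) :
  dps_bounded c -> De z -> De w ->
  cdiff2 (fun u v => dps c (/ u) (/ v)) z w
    (- (/ z * / z) * dps (dps_dl c) (/ z) (/ w)) (- (/ w * / w) * dps (dps_dr c) (/ z) (/ w)).
Proof.
intros Hc Hz Hw.
eapply cdiff2_eq; [| |apply (cdiff2_comp (dps c) (fun u _ => / u) (fun _ v => / v))].
4: now apply cdiff2_inv_fst. 4: now apply cdiff2_inv_snd.
3: { apply cdiff2_dps; try now apply De_inv. easy. }
all: simpl; ring.
Qed.

Lemma cdiff2_quot_series (c0 : nat -> nat -> C) (Q : C -> C -> C) (z w : C) :
  dps_bounded c0 -> De z -> De w ->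
  cdiff2 (quot_series c0) z w (eval c0 Q (quot_dl c0) z w) (eval c0 Q (quot_dr c0) z w).
Proof.
intros Hc Hz Hw. unfold quot_series.
eapply cdiff2_eq; [| |apply (cdiff2_plus _ _ z w _ _ _ _ (cdiff2_const 1 z w)
  (cdiff2_mult _ _ z w _ _ _ _ (cdiff2_const (-(1)) z w)
    (cdiff2_mult _ _ z w _ _ _ _ (cdiff2_inv_fst z w Hz)
      (cdiff2_mult _ _ z w _ _ _ _ (cdiff2_inv_snd z w Hw) (cdiff2_dps_inv c0 z w Hc Hz Hw)))))];
simpl; ring.
Qed.

(** All that the calculus of derivatives retains of psi and the branch: a convergent quotient and a
    once differentiable logarithm of it. *)
Definition is_log_quot (c0 : nat -> nat -> C) (Q : C -> C -> C) : Prop :=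
  dps_bounded c0 /\
  (forall z w, De z -> De w -> Cexp (Q z w) = quot_series c0 z w) /\
  (forall z w, De z -> De w -> exists a b, cdiff2 Q z w a b).

Lemma quot_series_neq_0 (c0 : nat -> nat -> C) (Q : C -> C -> C) (z w : C) :
  is_log_quot c0 Q -> De z -> De w -> quot_series c0 z w <> 0.
Proof. intros [_ [HE _]] Hz Hw. rewrite <- HE by easy. apply Cexp_neq_0. Qed.

(** Some derivative of [Q] exists by hypothesis. Differentiating exp Q = quotient and comparing by
    uniqueness determines its value. *)
Lemma cdiff2_log_quot (c0 : nat -> nat -> C) (Q : C -> C -> C) (z w : C) :
  is_log_quot c0 Q -> De z -> De w ->
  cdiff2 Q z w (eval c0 Q (dl c0 ELog) z w) (eval c0 Q (dr c0 ELog) z w).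
Proof.
intros HQ Hz Hw. assert (H0 := quot_series_neq_0 c0 Q z w HQ Hz Hw).
destruct HQ as [Hc [HE HD]].
destruct (HD z w Hz Hw) as [a [b Hab]].
assert (H1 := cdiff2_quot_series c0 Q z w Hc Hz Hw).
assert (H2 := cdiff2_comp _ Q Q z w _ _ _ _ _ _ (cdiff2_Cexp (Q z w) (Q z w)) Hab Hab).
apply (cdiff2_ext_De _ (quot_series c0)) in H2; [|easy|easy|exact HE].
destruct (cdiff2_unique _ _ _ _ _ _ _ H1 H2) as [Ea Eb].
simpl. simpl in Ea, Eb. rewrite HE in Ea, Eb by easy.
apply (cdiff2_eq _ z w a b); [| |easy].
- rewrite Ea. now field.
- rewrite Eb. now field.
Qed.

Lemma cdiff2_eval (c0 : nat -> nat -> C) (Q : C -> C -> C) (e : expr) (z w : C) :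
  is_log_quot c0 Q -> wf e -> De z -> De w ->
  cdiff2 (eval c0 Q e) z w (eval c0 Q (dl c0 e) z w) (eval c0 Q (dr c0 e) z w).
Proof.
intros HQ He Hz Hw. induction e.
- exact (cdiff2_const c z w).
- apply (cdiff2_eq _ z w (- (/ z * / z)) 0); try (simpl; ring). now apply cdiff2_inv_fst.
- apply (cdiff2_eq _ z w 0 (- (/ w * / w))); try (simpl; ring). now apply cdiff2_inv_snd.
- eapply cdiff2_eq; [| |apply (cdiff2_dps_inv c z w He Hz Hw)]; simpl; ring.
- eapply cdiff2_eq; [| |apply (cdiff2_inv _ z w _ _ (quot_series_neq_0 c0 Q z w HQ Hz Hw)
    (cdiff2_quot_series c0 Q z w (proj1 HQ) Hz Hw))]; simpl; ring.
- now apply cdiff2_log_quot.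
- destruct He as [He1 He2]. apply cdiff2_plus; auto.
- destruct He as [He1 He2].
  eapply cdiff2_eq; [| |apply (cdiff2_mult _ _ z w _ _ _ _ (IHe1 He1) (IHe2 He2))]; simpl; ring.
Qed.

(** Formal derivatives are true derivatives, hence depend only on values; this allows rewriting
    under further [dl] and [dr] where expressions agree only in value. *)
Lemma eval_d_ext (c0 : nat -> nat -> C) (Q : C -> C -> C) (e e' : expr) :
  is_log_quot c0 Q -> wf e -> wf e' ->
  (forall z w, De z -> De w -> eval c0 Q e z w = eval c0 Q e' z w) ->
  forall z w, De z -> De w ->
    eval c0 Q (dl c0 e) z w = eval c0 Q (dl c0 e') z w /\
    eval c0 Q (dr c0 e) z w = eval c0 Q (dr c0 e') z w.
Proof.
intros HQ He He' E z w Hz Hw.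
apply cdiff2_unique with (eval c0 Q e') z w; [|now apply cdiff2_eval].
apply (cdiff2_ext_De (eval c0 Q e)); try easy. now apply cdiff2_eval.
Qed.

(** Composing with the exchange of the variables exchanges the two partials. *)
Lemma eval_d_swap (c0 : nat -> nat -> C) (Q : C -> C -> C) (e e' : expr) :
  is_log_quot c0 Q -> wf e -> wf e' ->
  (forall z w, De z -> De w -> eval c0 Q e z w = eval c0 Q e' w z) ->
  forall z w, De z -> De w ->
    eval c0 Q (dl c0 e) z w = eval c0 Q (dr c0 e') w z /\
    eval c0 Q (dr c0 e) z w = eval c0 Q (dl c0 e') w z.
Proof.
intros HQ He He' E z w Hz Hw.
apply cdiff2_unique with (eval c0 Q e) z w; [now apply cdiff2_eval|].
apply (cdiff2_ext_De (fun u v => eval c0 Q e' v u)); try easy.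
{ intros u v Hu Hv. now rewrite E. }
eapply cdiff2_eq; [| |apply (cdiff2_comp (eval c0 Q e') (fun _ v => v) (fun u _ => u) z w (eval c0 Q (dl c0 e') w z) (eval c0 Q (dr c0 e') w z) 0 1 1 0)].
3: now apply cdiff2_eval. 3: apply cdiff2_snd. 3: apply cdiff2_fst.
all: ring.
Qed.

Lemma eval_dr_iter_dl (c0 : nat -> nat -> C) (Q : C -> C -> C) (e : expr) (n : nat) :
  is_log_quot c0 Q -> wf e -> forall z w, De z -> De w ->
  eval c0 Q (dr c0 (Nat.iter n (dl c0) e)) z w = eval c0 Q (Nat.iter n (dl c0) (dr c0 e)) z w.
Proof.
intros HQ He. assert (Hc := proj1 HQ). induction n as [|n IH]; intros z w Hz Hw; simpl; [easy|].
rewrite <- eval_dl_dr. apply eval_d_ext; try easy.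
- now apply wf_dr, wf_iter_dl.
- now apply wf_iter_dl, wf_dr.
Qed.

Lemma eval_iter_dr_iter_dl (c0 : nat -> nat -> C) (Q : C -> C -> C) (e : expr) (n m : nat) :
  is_log_quot c0 Q -> wf e -> forall z w, De z -> De w ->
  eval c0 Q (Nat.iter m (dr c0) (Nat.iter n (dl c0) e)) z w =
  eval c0 Q (Nat.iter n (dl c0) (Nat.iter m (dr c0) e)) z w.
Proof.
intros HQ He. assert (Hc := proj1 HQ). induction m as [|m IH]; intros z w Hz Hw; simpl; [easy|].
rewrite <- eval_dr_iter_dl by (try easy; now apply wf_iter_dr).
apply eval_d_ext; try easy.
- now apply wf_iter_dr, wf_iter_dl.
- now apply wf_iter_dl, wf_iter_dr.
Qed.

Definition partial_expr (c0 : nat -> nat -> C) (n m : nat) : expr :=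
  Nat.iter n (dl c0) (Nat.iter m (dr c0) ELog).

Lemma wf_partial_expr (c0 : nat -> nat -> C) (n m : nat) :
  dps_bounded c0 -> wf (partial_expr c0 n m).
Proof. intros H. now apply wf_iter_dl, wf_iter_dr. Qed.

Lemma partial_expr_swap (c0 : nat -> nat -> C) (Q : C -> C -> C) (n m : nat) (z w : C) :
  is_log_quot c0 Q -> (forall u v, De u -> De v -> Q u v = Q v u) -> De z -> De w ->
  eval c0 Q (partial_expr c0 n m) z w = eval c0 Q (partial_expr c0 m n) w z.
Proof.
intros HQ HS Hz Hw. assert (Hc := proj1 HQ).
(* Bringing the [dr] steps outermost on the right lets the induction peel off a [dl] on the left
   together with a [dr] on the right. *)
unfold partial_expr at 2. rewrite <- eval_iter_dr_iter_dl by easy.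
revert z w Hz Hw. unfold partial_expr. induction n as [|n IH]; intros z w Hz Hw.
- simpl. revert z w Hz Hw. induction m as [|m IH]; intros z w Hz Hw; simpl.
  + now apply HS.
  + apply eval_d_swap; try easy. now apply wf_iter_dr. now apply wf_iter_dl.
- simpl. apply eval_d_swap; try easy.
  now apply wf_iter_dl, wf_iter_dr. now apply wf_iter_dr, wf_iter_dl.
Qed.

Lemma is_derive_diag_partial (c0 : nat -> nat -> C) (Q : C -> C -> C) (n m : nat) (z : C) :
  is_log_quot c0 Q -> De z ->
  @is_derive C_AbsRing C_NormedModule (fun u => eval c0 Q (partial_expr c0 n m) u u) z
    (eval c0 Q (partial_expr c0 (S n) m) z z + eval c0 Q (partial_expr c0 n (S m)) z z).
Proof.
intros HQ Hz. assert (Hc := proj1 HQ).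
replace (eval c0 Q (partial_expr c0 n (S m)) z z) with (eval c0 Q (dr c0 (partial_expr c0 n m)) z z).
2: { apply eval_dr_iter_dl; try easy. now apply wf_iter_dr. }
apply (cdiff2_is_derive_diag (eval c0 Q (partial_expr c0 n m))).
apply cdiff2_eval; try easy. now apply wf_partial_expr.
Qed.

(** Differentiating once more needs agreement of [C_derive_n g k] with [f k] near the point, not
    just at it; openness of [De] supplies this. *)
Lemma C_derive_n_family (g : C -> C) (f : nat -> C -> C) :
  (forall z, De z -> g z = f O z) ->
  (forall k z, De z -> @is_derive C_AbsRing C_NormedModule (f k) z (f (S k) z)) ->
  forall k z, De z -> C_derive_n g k z = f k z.
Proof.
intros H0 H k. induction k as [|k IH]; intros z Hz; simpl; [now apply H0|].
apply is_C_derive_unique.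
apply (is_derive_ext_loc (K := C_AbsRing) (V := C_NormedModule) (f k)).
2: now apply H.
destruct (De_open z Hz) as [r [Hr HO]]. exists (mkposreal r Hr). intros y Hy.
symmetry. apply IH. change C in y. change (Cmod (y - z) < r)%R in Hy.
specialize (HO _ Hy). now replace (z + (y - z)) with y in HO by ring.
Qed.

Lemma C_partial_eval (c0 : nat -> nat -> C) (Q : C -> C -> C) (n m : nat) (z w : C) :
  is_log_quot c0 Q -> De z -> De w ->
  C_partial n m Q z w = eval c0 Q (partial_expr c0 n m) z w.
Proof.
intros HQ Hz Hw. unfold C_partial. assert (Hc := proj1 HQ).
apply (C_derive_n_family _ (fun k u => eval c0 Q (partial_expr c0 k m) u w)); [| |easy].
- intros u Hu.
  apply (C_derive_n_family _ (fun k v => eval c0 Q (Nat.iter k (dr c0) ELog) u v)); [easy| |easy].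
  intros k v Hv. apply (cdiff2_is_derive_r (eval c0 Q (Nat.iter k (dr c0) ELog)) u v (eval c0 Q (dl c0 (Nat.iter k (dr c0) ELog)) u v)).
  apply cdiff2_eval; try easy. now apply wf_iter_dr.
- intros k u Hu. apply (cdiff2_is_derive_l (eval c0 Q (partial_expr c0 k m)) u w _ (eval c0 Q (dr c0 (partial_expr c0 k m)) u w)).
  apply (cdiff2_eval c0 Q (partial_expr c0 k m)); try easy. now apply wf_partial_expr.
Qed.

(** * The branch Q_e *)

(** Since x^(n+1) - y^(n+1) is (x - y) times the sum of x^i y^j over i + j = n, the monomial x^i y^j
    collects the coefficient of index i + j + 1. *)
Definition laurent_coef (b : nat -> C) (i j : nat) : C := b (S (i + j)).

Definition laurent_expansion (psi : C -> C) (b : nat -> C) : Prop :=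
  forall z : C, De z -> @is_series C_AbsRing C_NormedModule
    (fun j => b j * (/ z) ^ j) (psi z - z).

Lemma Re_sum_n (u : nat -> C) (n : nat) :
  Re (@sum_n C_AbelianMonoid u n) = sum_n (fun j => Re (u j)) n.
Proof.
induction n as [|n IH]; [now rewrite !sum_O|]. rewrite !sum_Sn. rewrite <- IH. easy.
Qed.

Lemma Im_sum_n (u : nat -> C) (n : nat) :
  Im (@sum_n C_AbelianMonoid u n) = sum_n (fun j => Im (u j)) n.
Proof.
induction n as [|n IH]; [now rewrite !sum_O|]. rewrite !sum_Sn. rewrite <- IH. easy.
Qed.

Lemma is_series_CSeries (u : nat -> C) (l : C) :
  @is_series C_AbsRing C_NormedModule u l -> CSeries u = l.
Proof.
intros H. apply injective_projections; simpl; apply is_series_unique; intros P [d Hd].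
- assert (L : locally (T := C_UniformSpace) l (fun y => P (fst y))).
  { exists d. intros y [Hy _]. now apply Hd. }
  destruct (H _ L) as [N HN]. exists N. intros n Hn.
  specialize (HN n Hn). rewrite <- Re_sum_n. exact HN.
- assert (L : locally (T := C_UniformSpace) l (fun y => P (snd y))).
  { exists d. intros y [_ Hy]. now apply Hd. }
  destruct (H _ L) as [N HN]. exists N. intros n Hn.
  specialize (HN n Hn). rewrite <- Im_sum_n. exact HN.
Qed.

(** At the real point 1 / r of [De] the Laurent series converges; its partial sums are bounded by
    some M, hence its terms by 2 M. *)
Lemma laurent_coef_bound (psi : C -> C) (b : nat -> C) (r : R) :
  laurent_expansion psi b -> (0 < r < 1)%R ->
  exists M : R, (0 < M)%R /\ forall n, (Cmod (b n) * r ^ n <= M)%R.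
Proof.
intros H Hr.
assert (Hz : De (RtoC (/ r))).
{ unfold De. rewrite Cmod_R, Rabs_right.
  - rewrite <- Rinv_1. apply Rinv_lt_contravar; lra.
  - apply Rle_ge, Rlt_le, Rinv_0_lt_compat; lra. }
specialize (H _ Hz).
destruct (@filterlim_bounded C_AbsRing C_NormedModule _ (ex_intro _ _ H)) as [M HM].
set (u := fun j => b j * (/ RtoC (/ r)) ^ j) in *.
change (forall n, (Cmod (@sum_n C_AbelianMonoid u n) <= M)%R) in HM.
assert (Hu : forall n, (Cmod (u n) <= 2 * M)%R).
{ intros [|n].
  - assert (T : (Cmod (u O) <= M)%R) by (generalize (HM O); now rewrite sum_O). assert (T0 := Cmod_ge_0 (u O)). lra.
  - assert (T0 := HM n). assert (T1 := HM (S n)). rewrite sum_Sn in T1.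
    set (s := @sum_n C_AbelianMonoid u n) in *.
    change (Cmod (s + u (S n)) <= M)%R in T1.
    assert (T := Cmod_triangle (s + u (S n)) (- s)). rewrite Cmod_opp in T.
    replace (s + u (S n) + - s) with (u (S n)) in T by ring. lra. }
exists (Rmax 1 (2 * M)). split; [eapply Rlt_le_trans; [apply Rlt_0_1|apply Rmax_l]|].
intros n. eapply Rle_trans; [|apply Rmax_r]. eapply Rle_trans; [|apply (Hu n)].
unfold u. rewrite Cmod_mult, Cmod_pow.
replace (/ RtoC (/ r)) with (RtoC r).
2: { rewrite <- RtoC_inv; [now rewrite Rinv_inv|]. apply Rinv_neq_0_compat. lra. }
rewrite Cmod_R, Rabs_right by lra. lra.
Qed.

Lemma laurent_coef_bounded (psi : C -> C) (b : nat -> C) :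
  laurent_expansion psi b -> dps_bounded (laurent_coef b).
Proof.
intros H r Hr. destruct (laurent_coef_bound psi b r H Hr) as [M [HM HB]].
exists (M / r)%R. split; [apply Rdiv_lt_0_compat; lra|].
intros i j. specialize (HB (S (i + j))). unfold laurent_coef. simpl in HB |- *.
apply Rmult_le_reg_r with r; [lra|].
replace (M / r * r)%R with M by (field; lra). lra.
Qed.

Lemma laurent_summable (psi : C -> C) (b : nat -> C) (x : C) :
  laurent_expansion psi b -> (Cmod x < 1)%R -> Csummable (fun j => b j * x ^ j).
Proof.
intros H Hx. assert (Hx0 := Cmod_ge_0 x).
set (r := ((1 + Cmod x) / 2)%R). assert (Hr : (0 < r < 1)%R) by (unfold r; lra).
destruct (laurent_coef_bound psi b r H Hr) as [M [HM HB]].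
apply Csummable_le with (fun j => (M * (Cmod x / r) ^ j)%R).
- intros n. rewrite Cmod_mult, Cmod_pow.
  assert (Hrn := pow_lt r n (proj1 Hr)).
  replace (Cmod (b n) * Cmod x ^ n)%R with (Cmod (b n) * r ^ n * (Cmod x / r) ^ n)%R.
  + apply Rmult_le_compat_r; [|apply HB]. apply pow_le.
    apply Rmult_le_pos; [easy|]. apply Rlt_le, Rinv_0_lt_compat; lra.
  + unfold Rdiv. rewrite Rpow_mult_distr, pow_inv. field. lra.
- apply (ex_series_scal (V := R_NormedModule)).
  exists (/ (1 - Cmod x / r))%R. apply is_series_geom. rewrite Rabs_right.
  + apply Rmult_lt_reg_r with r; [lra|]. unfold Rdiv. rewrite Rmult_assoc, Rinv_l by lra.
    unfold r. lra.
  + apply Rle_ge, Rmult_le_pos; [easy|]. apply Rlt_le, Rinv_0_lt_compat; lra.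
Qed.

Lemma geometric_factorization (x y : C) (n : nat) :
  (x - y) * Csum (fun a => x ^ a * y ^ (n - a)) (S n) = x ^ S n - y ^ S n.
Proof.
induction n as [|n IH]; [simpl; ring|].
change (Csum (fun a => x ^ a * y ^ (S n - a)) (S (S n))) with
  (Csum (fun a => x ^ a * y ^ (S n - a)) (S n) + x ^ S n * y ^ (S n - S n)).
rewrite Nat.sub_diag.
rewrite (Csum_ext _ (fun a => y * (x ^ a * y ^ (n - a)))).
- rewrite Csum_scal.
  replace ((x - y) * (y * Csum (fun a => x ^ a * y ^ (n - a)) (S n) + x ^ S n * y ^ 0)) with
   (y * ((x - y) * Csum (fun a => x ^ a * y ^ (n - a)) (S n)) + (x - y) * x ^ S n) by (simpl; ring).
  rewrite IH. rewrite !(Cpow_S _ (S n)). ring.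
- intros i Hi. replace (S n - i)%nat with (S (n - i)) by lia. rewrite Cpow_S. ring.
Qed.

Lemma laurent_difference (psi : C -> C) (b : nat -> C) (z w : C) :
  laurent_expansion psi b -> De z -> De w ->
  psi z - psi w = (z - w) * quot_series (laurent_coef b) z w.
Proof.
intros H Hz Hw.
assert (Hx := De_inv z Hz). assert (Hy := De_inv w Hw).
assert (Sx := laurent_summable psi b _ H Hx). assert (Sy := laurent_summable psi b _ H Hy).
assert (Ez := is_series_CSeries _ _ (H z Hz)). assert (Ew := is_series_CSeries _ _ (H w Hw)).
replace (psi z - psi w) with (z - w + ((psi z - z) - (psi w - w))) by ring.
rewrite <- Ez, <- Ew.
assert (Hz0 := De_neq_0 z Hz). assert (Hw0 := De_neq_0 w Hw).
unfold quot_series. set (x := / z) in *. set (y := / w) in *.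
(* Uses -(z - w) x y = x - y. *)
replace ((z - w) * (1 + - (1) * (x * (y * dps (laurent_coef b) x y)))) with
  (z - w + (x - y) * dps (laurent_coef b) x y) by (unfold x, y; now field).
f_equal. unfold dps.
rewrite <- CSeries_scal by (apply dps_summable; try easy; now apply laurent_coef_bounded with psi).
assert (Sy' := Csummable_scal (-(1)) _ Sy).
replace (CSeries (fun j => b j * x ^ j) - CSeries (fun j => b j * y ^ j)) with
  (CSeries (fun j => b j * x ^ j + -(1) * (b j * y ^ j))).
2: { rewrite CSeries_plus, CSeries_scal by easy. ring. }
(* The constant term b_0 cancels; the shifted index then matches the layers of [dps_term]. *)
rewrite CSeries_incr_1 by now apply Csummable_plus.
replace (b O * x ^ 0 + - (1) * (b O * y ^ 0)) with (RtoC 0) by (simpl; ring).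
rewrite Cplus_0_l. apply CSeries_ext. intros n.
unfold dps_term.
rewrite (Csum_ext _ (fun a => b (S n) * (x ^ a * y ^ (n - a)))).
- rewrite Csum_scal.
  replace ((x - y) * (b (S n) * Csum (fun a => x ^ a * y ^ (n - a)) (S n))) with
    (b (S n) * ((x - y) * Csum (fun a => x ^ a * y ^ (n - a)) (S n))) by ring.
  rewrite geometric_factorization. ring.
- intros i Hi. unfold laurent_coef. now replace (i + (n - i))%nat with n by lia.
Qed.

(** Continuity at the diagonal point, tested along (z, z + t) for small real t > 0. *)
Lemma cdiff2_zero_of_punctured (F : C -> C -> C) (z a b : C) :
  De z -> cdiff2 F z z a b ->
  (forall u v, De u -> De v -> u <> v -> F u v = 0) -> F z z = 0.
Proof.
intros Hz HF H0. apply Cmod_eq_0.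
destruct (cdiff2_lipschitz _ _ _ _ _ HF) as [L [d [HL [Hd HB]]]].
destruct (De_open z Hz) as [r [Hr HO]].
apply Rle_antisym; [|apply Cmod_ge_0]. apply le_epsilon. intros eps He. rewrite Rplus_0_l.
set (t := Rmin (Rmin (d / 2) (r / 2)) (eps / L)).
assert (Ht : (0 < t /\ t < d /\ t < r /\ t <= eps / L)%R).
{ assert (0 < eps / L)%R by now apply Rdiv_lt_0_compat.
  unfold t. unfold Rmin. repeat destruct Rle_dec; lra. }
clearbody t. destruct Ht as [Ht [Ht1 [Ht2 Ht3]]].
assert (Mt : Cmod (RtoC t) = t) by (rewrite Cmod_R; apply Rabs_right; lra).
specialize (HB 0 (RtoC t)). rewrite Mt, Cmod_0 in HB. specialize (HB Hd Ht1).
rewrite (H0 (z + 0) (z + RtoC t)) in HB.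
- replace (0 - F z z) with (- F z z) in HB by ring. rewrite Cmod_opp in HB.
  eapply Rle_trans; [exact HB|]. rewrite Rplus_0_l.
  apply Rle_trans with (L * (eps / L))%R; [apply Rmult_le_compat_l; lra|].
  apply Req_le. field. lra.
- apply HO. now rewrite Cmod_0.
- apply HO. now rewrite Mt.
- intros E. assert (E' : RtoC t = 0).
  { replace (RtoC t) with ((z + RtoC t) - (z + 0)) by ring. rewrite <- E. ring. }
  rewrite E', Cmod_0 in Mt. lra.
Qed.

(** Off the diagonal this is division by z - w. On the diagonal it follows by continuity of both
    sides, so psi' need not be computed from the series. *)
Lemma is_log_quot_laurent (psi : C -> C) (b : nat -> C) (Q : C -> C -> C) :
  laurent_expansion psi b -> is_Qe psi Q -> is_log_quot (laurent_coef b) Q.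
Proof.
intros Hb [Hhol [HE _]].
assert (Hc := laurent_coef_bounded psi b Hb).
assert (HD : forall z w, De z -> De w -> exists a b, cdiff2 Q z w a b).
{ intros z w Hz Hw. now apply holomorphic_De2_cdiff2. }
assert (Hoff : forall z w, De z -> De w -> z <> w -> Cexp (Q z w) = quot_series (laurent_coef b) z w).
{ intros z w Hz Hw Hn. rewrite HE by easy. unfold diff_quot. destruct (Ceq_dec z w); [easy|].
  rewrite (laurent_difference psi b) by easy. field. intros E. apply Hn.
  replace z with ((z - w) + w) by ring. rewrite E. ring. }
split; [easy|]. split; [|easy].
intros z w Hz Hw. destruct (Ceq_dec z w) as [<-|Hn]; [|now apply Hoff].
destruct (HD z z Hz Hz) as [p [q HQ]].
assert (H1 := cdiff2_comp _ Q Q z z _ _ _ _ _ _ (cdiff2_Cexp (Q z z) (Q z z)) HQ HQ).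
assert (H2 := cdiff2_quot_series _ Q z z Hc Hz Hz).
assert (H3 := cdiff2_plus _ _ _ _ _ _ _ _ H1 (cdiff2_mult _ _ _ _ _ _ _ _ (cdiff2_const (-(1)) z z) H2)).
apply cdiff2_zero_of_punctured in H3; [|easy|].
- replace (Cexp (Q z z)) with ((Cexp (Q z z) + -(1) * quot_series (laurent_coef b) z z) + quot_series (laurent_coef b) z z) by ring.
  rewrite H3. ring.
- intros u v Hu Hv Hn. simpl. rewrite Hoff by easy. ring.
Qed.

(** * Symmetry of the branch *)

Lemma diff_quot_sym (psi : C -> C) (z w : C) : diff_quot psi z w = diff_quot psi w z.
Proof.
unfold diff_quot. destruct (Ceq_dec z w) as [E|E], (Ceq_dec w z) as [E'|E']; try congruence.
assert (z - w <> 0).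
{ intros H. apply E. replace z with ((z - w) + w) by ring. rewrite H. ring. }
assert (w - z <> 0).
{ intros H0. apply E'. replace w with ((w - z) + z) by ring. rewrite H0. ring. }
field. easy.
Qed.

Lemma De_ray (z : C) (t : R) : De z -> (1 <= t)%R -> De (RtoC t * z).
Proof. unfold De. intros Hz Ht. rewrite Cmod_mult, Cmod_R, Rabs_right; nra. Qed.

Lemma continuity_pt_of_lipschitz (f : R -> R) (t L d : R) :
  (0 < L)%R -> (0 < d)%R ->
  (forall h, (Rabs h < d)%R -> (Rabs (f (t + h) - f t) <= L * Rabs h)%R) -> continuity_pt f t.
Proof.
intros HL Hd H eps He. exists (Rmin d (eps / (2 * L))). split.
{ apply Rmin_glb_lt; [easy|]. apply Rdiv_lt_0_compat; lra. }
intros x; change R in x; intros [_ Hx]. simpl in Hx |- *. unfold Rdist in *.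
assert (H1 := Rlt_le_trans _ _ _ Hx (Rmin_l _ _)). assert (H2 := Rlt_le_trans _ _ _ Hx (Rmin_r _ _)).
specialize (H (x - t)%R H1). replace (t + (x - t))%R with x in H by ring.
eapply Rle_lt_trans; [exact H|].
apply Rlt_le_trans with (L * (eps / L))%R.
- apply Rmult_lt_compat_l; [easy|].
  apply Rlt_le_trans with (eps / (2 * L))%R; [easy|].
  apply Rmult_le_compat_l; [lra|]. apply Rinv_le_contravar; lra.
- apply Req_le. field. lra.
Qed.

(* Along a ray to infinity the difference [Q z w - Q w z] is a continuous
   function valued in the multiples of 2 pi i and tending to 0. *)
Lemma Im_Q_sym_le (psi : C -> C) (b : nat -> C) (Q : C -> C -> C) (z w : C) :
  laurent_expansion psi b -> is_Qe psi Q -> De z -> De w ->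
  (Im (Q z w - Q w z) <= 0)%R.
Proof.
intros Hb HQ Hz Hw. assert (HL := is_log_quot_laurent psi b Q Hb HQ).
destruct HQ as [Hhol [HE [H1 H2]]].
apply Rnot_lt_le. intros Hpos.
set (g := fun t : R => Im (Q (RtoC t * z) w - Q w (RtoC t * z))).
assert (G1 : g 1%R = Im (Q z w - Q w z)) by (unfold g; now rewrite Cmult_1_l).
(* A level strictly between 0 and g 1, and at most 1 < pi, so that sin does not vanish there; g must
   cross it on its way to 0. *)
set (c := Rmin (g 1%R / 2) 1).
assert (Hc : (0 < c <= 1)%R).
{ split; [apply Rmin_glb_lt; lra|apply Rmin_r]. }
assert (Hc1 : (c < g 1)%R) by (eapply Rle_lt_trans; [apply Rmin_l|lra]).
assert (Hsin : forall t, (1 <= t)%R -> sin (g t) = 0%R).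
{ intros t Ht. assert (Ht' := De_ray z t Hz Ht).
  assert (E : Cexp (Q (RtoC t * z) w - Q w (RtoC t * z)) = 1).
  { set (p := Q (RtoC t * z) w). set (q := Q w (RtoC t * z)).
    assert (K : Cexp (p - q) * Cexp q = Cexp q).
    { rewrite <- Cexp_plus. replace (p - q + q) with p by ring.
      unfold p, q. rewrite !HE by easy. apply diff_quot_sym. }
    replace (Cexp (p - q)) with (Cexp (p - q) * Cexp q * / Cexp q) by (field; apply Cexp_neq_0).
    rewrite K. field. apply Cexp_neq_0. }
  apply (f_equal snd) in E. simpl in E.
  apply Rmult_integral in E. destruct E as [E|E]; [|exact E].
  assert (T := exp_pos (Re (Q (RtoC t * z) w - Q w (RtoC t * z)))). simpl in T. lra. }
assert (Hcont : forall t, (1 <= t)%R -> continuity_pt g t).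
{ intros t Ht. assert (Ht' := De_ray z t Hz Ht).
  assert (D1 := cdiff2_log_quot _ _ _ _ HL Ht' Hw). assert (D2 := cdiff2_log_quot _ _ _ _ HL Hw Ht').
  destruct (cdiff2_lipschitz _ _ _ _ _ D1) as [L1 [d1 [HL1 [Hd1 B1]]]].
  destruct (cdiff2_lipschitz _ _ _ _ _ D2) as [L2 [d2 [HL2 [Hd2 B2]]]].
  assert (Hm : (1 < Cmod z)%R) by exact Hz.
  (* Moving t by h moves the point on the ray by h z, whence the factors |z|. *)
  apply (continuity_pt_of_lipschitz g t ((L1 + L2) * Cmod z) (Rmin d1 d2 / Cmod z)).
  { apply Rmult_lt_0_compat; lra. }
  { apply Rdiv_lt_0_compat; [|lra]. now apply Rmin_glb_lt. }
  intros h Hh.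
  assert (Hh' : (Cmod (RtoC h * z) < Rmin d1 d2)%R).
  { rewrite Cmod_mult, Cmod_R. apply Rmult_lt_reg_r with (/ Cmod z)%R; [apply Rinv_0_lt_compat; lra|].
    rewrite Rmult_assoc, Rinv_r by lra. rewrite Rmult_1_r. exact Hh. }
  specialize (B1 (RtoC h * z) 0). specialize (B2 0 (RtoC h * z)).
  rewrite Cmod_0, Cplus_0_r, Cmod_mult, Cmod_R in B1, B2.
  rewrite Cmod_mult, Cmod_R in Hh'.
  specialize (B1 (Rlt_le_trans _ _ _ Hh' (Rmin_l _ _)) Hd1).
  specialize (B2 Hd2 (Rlt_le_trans _ _ _ Hh' (Rmin_r _ _))).
  unfold g.
  replace (RtoC (t + h) * z) with (RtoC t * z + RtoC h * z) by (rewrite RtoC_plus; ring).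
  set (A := Q (RtoC t * z + RtoC h * z) w - Q (RtoC t * z) w) in *.
  set (B := Q w (RtoC t * z + RtoC h * z) - Q w (RtoC t * z)) in *.
  match goal with |- (Rabs (Im ?p - Im ?q) <= _)%R => replace (Im p - Im q)%R with (Im A - Im B)%R by (unfold A, B; simpl; ring) end.
  eapply Rle_trans; [apply Rabs_triang|]. rewrite Rabs_Ropp.
  assert (I1 := Im_le_Cmod A). assert (I2 := Im_le_Cmod B). lra. }
assert (Hlim : exists T, (1 < T)%R /\ (g T < c)%R).
{ assert (L0 : locally (RtoC 0) (fun y : C => Rabs (Im y) < c / 2)%R).
  { assert (Hc2 : (0 < c / 2)%R) by lra. exists (mkposreal _ Hc2). intros y [_ Hy].
    change (Rabs (Im y - 0) < c / 2)%R in Hy. now rewrite Rminus_0_r in Hy. }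
  destruct (H1 w Hw _ L0) as [M1 HM1]. destruct (H2 w Hw _ L0) as [M2 HM2].
  exists (2 + Rabs M1 + Rabs M2)%R. set (T := (2 + Rabs M1 + Rabs M2)%R).
  assert (P1 := Rle_abs M1). assert (P2 := Rle_abs M2).
  assert (P3 := Rabs_pos M1). assert (P4 := Rabs_pos M2).
  split; [unfold T; lra|].
  assert (HT : (T < Cmod (RtoC T * z))%R).
  { rewrite Cmod_mult, Cmod_R, Rabs_right by (unfold T; lra). unfold De in Hz.
    assert (0 < T)%R by (unfold T; lra). nra. }
  assert (Q1 := HM1 (RtoC T * z) ltac:(unfold T in *; lra)).
  assert (Q2 := HM2 (RtoC T * z) ltac:(unfold T in *; lra)).
  simpl in Q1, Q2. apply Rabs_def2 in Q1. apply Rabs_def2 in Q2.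
  unfold g. simpl in *. unfold Im in *. lra. }
destruct Hlim as [T [HT HgT]].
(* The intermediate value theorem is stated for a change from negative to positive, hence c - g. *)
destruct (Ranalysis5.IVT_interv (fun t => c - g t)%R 1 T) as [t [[Ht1 Ht2] Ht]]; try lra.
{ intros t Ht. apply continuity_pt_minus; [apply continuity_pt_const; now intros ? ?|apply Hcont; lra]. }
assert (E := Hsin t Ht1). replace (g t) with c in E by lra.
assert (S := sin_gt_0 c ltac:(lra)). assert (HPI := PI2_1).
assert (c < PI)%R by lra. specialize (S H). lra.
Qed.

(** The inequality and its counterpart with z and w exchanged give equal imaginary parts; equal
    exponentials then force equal real parts. *)
Lemma Q_sym (psi : C -> C) (b : nat -> C) (Q : C -> C -> C) (z w : C) :
  laurent_expansion psi b -> is_Qe psi Q -> De z -> De w -> Q z w = Q w z.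
Proof.
intros Hb HQ Hz Hw.
assert (A := Im_Q_sym_le psi b Q z w Hb HQ Hz Hw).
assert (B := Im_Q_sym_le psi b Q w z Hb HQ Hw Hz). simpl in A, B.
assert (E : Cexp (Q z w) = Cexp (Q w z)).
{ destruct HQ as [_ [HE _]]. rewrite !HE by easy. apply diff_quot_sym. }
assert (I : Im (Q z w) = Im (Q w z)) by (unfold Im; lra).
apply injective_projections; [|exact I].
assert (Ea := f_equal fst E). assert (Eb := f_equal snd E). simpl in Ea, Eb.
rewrite <- I in Ea, Eb.
set (p := Re (Q z w)) in *. set (q := Re (Q w z)) in *. set (y := Im (Q z w)) in *.
assert (Epq : exp p = exp q).
{ assert (T := sin2_cos2 y). unfold Rsqr in T.
  (* Recombining both components through sin^2 + cos^2 = 1 avoids asking which of sin y and cos y is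
     nonzero. *)
  replace (exp p) with ((exp p * sin y) * sin y + (exp p * cos y) * cos y)%R by (rewrite <- (Rmult_1_r (exp p)) at 3; rewrite <- T; ring).
  rewrite Ea, Eb. rewrite <- (Rmult_1_r (exp q)) at 3. rewrite <- T. ring. }
now apply exp_inv.
Qed.

(** * Derivatives along the diagonal *)

(** With X and Y shifting the two indices, this is (X + Y)^k applied to [A] at (n, m): the k-th
    derivative along the diagonal. *)
Fixpoint diag_iter (A : nat -> nat -> C) (k n m : nat) : C :=
  match k with
  | O => A n m
  | S k' => diag_iter A k' (S n) m + diag_iter A k' n (S m)
  end.

Lemma diag_iter_sym (A : nat -> nat -> C) : (forall n m, A n m = A m n) ->
  forall k n m, diag_iter A k n m = diag_iter A k m n.
Proof.
intros H k. induction k as [|k IH]; intros n m; simpl; [apply H|].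
rewrite (IH (S n)), (IH n (S m)). ring.
Qed.

(** The j-th entry at d is the coefficient of (X + Y)^(d - 2j) (X Y)^j in X^d + Y^d, so it starts
    from X^0 + Y^0 = 2. The pair holds d and d + 1, making the two-step recurrence structural. *)
Fixpoint lucas_pair (d : nat) : (nat -> R) * (nat -> R) :=
  match d with
  | O => (fun j => match j with O => 2%R | S _ => 0%R end,
          fun j => match j with O => 1%R | S _ => 0%R end)
  | S d' => let p := lucas_pair d' in
     (snd p, fun j => (snd p j - match j with O => 0 | S j' => fst p j' end)%R)
  end.

Definition lucas (d : nat) : nat -> R := fst (lucas_pair d).

Lemma lucas_SS (d j : nat) :
  lucas (S (S d)) j = (lucas (S d) j - match j with O => 0 | S j' => lucas d j' end)%R.
Proof. reflexivity. Qed.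

Lemma nat_two_step_ind (P : nat -> Prop) :
  P O -> P 1%nat -> (forall d, P d -> P (S d) -> P (S (S d))) -> forall d, P d.
Proof.
intros H0 H1 H. assert (K : forall d, P d /\ P (S d)).
{ induction d as [|d [IH1 IH2]]; auto. }
intros d. apply K.
Qed.

Lemma lucas_0 (d j : nat) : (d < 2 * j)%nat -> lucas d j = 0%R.
Proof.
revert d j. apply (nat_two_step_ind (fun d => forall j, (d < 2 * j)%nat -> lucas d j = 0%R)).
- intros [|j] Hj; [lia|reflexivity].
- intros [|j] Hj; [lia|reflexivity].
- intros d IH1 IH2 [|j] Hj; [lia|]. rewrite lucas_SS, IH1, IH2 by lia. ring.
Qed.

Lemma lucas_O (d : nat) : lucas (S d) 0 = 1%R.
Proof. induction d as [|d IH]; [reflexivity|]. rewrite lucas_SS, IH. ring. Qed.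

(** Putting d = 2j + p removes every subtraction from d / (d - j) C(d - j, j). The hypothesis
    excludes d = 0, where that quotient degenerates. *)
Lemma lucas_factorial (j p : nat) : (1 <= j + p)%nat ->
  lucas (2 * j + p) j =
  ((-1) ^ j * (INR (2 * j + p) / INR (j + p) * (INR (fact (j + p)) / (INR (fact j) * INR (fact p)))))%R.
Proof.
revert p. induction j as [|j IH]; intros p Hp.
- destruct p as [|p]; [lia|]. simpl (2 * 0 + S p)%nat. simpl (0 + S p)%nat.
  rewrite lucas_O. simpl (fact 0). simpl (INR 1). rewrite pow_O. field.
  split; [apply INR_fact_neq_0|now apply not_0_INR].
- clear Hp. induction p as [|p IHp].
  + replace (2 * S j + 0)%nat with (S (S (2 * j))) by lia.
    rewrite lucas_SS, lucas_0 by lia.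
    (* For p = 0 only the lower term of the recurrence survives; j = 0 is apart because the
       induction hypothesis does not cover d = 0. *)
    destruct j as [|j]; [unfold lucas; simpl; field|].
    assert (T := IH O ltac:(lia)). rewrite !Nat.add_0_r in *. rewrite T.
    rewrite !(fact_simpl (S j)), !mult_INR.
    simpl (fact 0). simpl (INR 1). rewrite !S_INR, !mult_INR, !S_INR. simpl (INR 0).
    assert (T1 := INR_fact_neq_0 (S j)). assert (T2 := pos_INR j).
    rewrite <- (tech_pow_Rmult _ (S j)). field. repeat split; try easy; lra.
  + replace (2 * S j + S p)%nat with (S (S (2 * j + S p))) by lia.
    rewrite lucas_SS. replace (S (2 * j + S p)) with (2 * S j + p)%nat by lia.
    rewrite IHp, IH by lia.
    replace (S j + S p)%nat with (S (S (j + p))) by lia.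
    replace (S j + p)%nat with (S (j + p)) by lia. replace (j + S p)%nat with (S (j + p)) by lia.
    rewrite (fact_simpl (S (j + p))), (fact_simpl j), (fact_simpl p), !mult_INR.
    replace (S (2 * S j + p)) with (2 * j + p + 3)%nat by lia.
    replace (2 * S j + p)%nat with (2 * j + p + 2)%nat by lia.
    replace (2 * j + S p)%nat with (2 * j + p + 1)%nat by lia.
    rewrite !S_INR, !plus_INR, !mult_INR. simpl (INR 2). simpl (INR 3). simpl (INR 1).
    assert (T1 := INR_fact_neq_0 j). assert (T2 := INR_fact_neq_0 p).
    assert (T3 := pos_INR j). assert (T4 := pos_INR p).
    rewrite <- (tech_pow_Rmult _ j). field. repeat split; try easy; lra.
Qed.

(** The order [k] stays general because the recurrence raises it. Any upper limit [N] beyond d will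
    do, and truncated subtraction in k + d - 2j is harmless, since [lucas d j] vanishes once 2j >
    d. *)
Lemma diag_iter_lucas (A : nat -> nat -> C) : (forall n m, A n m = A m n) ->
  forall d k m N, (d <= N)%nat ->
  2 * diag_iter A k (m + d) m =
  Csum (fun j => RtoC (lucas d j) * diag_iter A (k + d - 2 * j) (m + j) (m + j)) (S N).
Proof.
intros H. assert (HS := diag_iter_sym A H).
apply (nat_two_step_ind (fun d => forall k m N, (d <= N)%nat ->
  2 * diag_iter A k (m + d) m =
  Csum (fun j => RtoC (lucas d j) * diag_iter A (k + d - 2 * j) (m + j) (m + j)) (S N))).
- intros k m N _. rewrite Csum_first.
  rewrite (Csum_ext _ (fun j => 0 * 0)), Csum_scal.
  2: { intros i _. rewrite lucas_0 by lia. ring. }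
  replace (k + 0 - 2 * 0)%nat with k by lia. rewrite !Nat.add_0_r.
  unfold lucas; simpl. ring.
- intros k m N _. rewrite Csum_first.
  rewrite (Csum_ext _ (fun j => 0 * 0)), Csum_scal.
  2: { intros i _. rewrite lucas_0 by lia. ring. }
  replace (k + 1 - 2 * 0)%nat with (S k) by lia. rewrite !Nat.add_0_r, Nat.add_1_r.
  unfold lucas; simpl. rewrite (HS k m (S m)). ring.
- intros d IH1 IH2 k m N HN. destruct N as [|N]; [lia|].
  (* X^(d+2) = (X + Y) X^(d+1) - (X Y) X^d, applied at (m, m). *)
  assert (E : 2 * diag_iter A k (m + S (S d)) m =
     2 * diag_iter A (S k) (m + S d) m - 2 * diag_iter A k (S m + d) (S m)).
  { change (diag_iter A (S k) (m + S d) m) with (diag_iter A k (S (m + S d)) m + diag_iter A k (m + S d) (S m)).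
    replace (m + S (S d))%nat with (S (m + S d)) by lia.
    replace (S m + d)%nat with (m + S d)%nat by lia. ring. }
  rewrite E, (IH2 (S k) m (S N)), (IH1 k (S m) N) by lia.
  rewrite !(Csum_first _ (S N)).
  rewrite (Csum_ext (fun i => RtoC (lucas (S (S d)) (S i)) * _)
    (fun i => RtoC (lucas (S d) (S i)) * diag_iter A (S k + S d - 2 * S i) (m + S i) (m + S i)
       + -(1) * (RtoC (lucas d i) * diag_iter A (k + d - 2 * i) (S m + i) (S m + i)))).
  + rewrite Csum_plus, Csum_scal. rewrite !lucas_O.
    replace (k + S (S d) - 2 * 0)%nat with (S k + S d - 2 * 0)%nat by lia. ring.
  + intros i _. rewrite lucas_SS, RtoC_minus.
    replace (k + S (S d) - 2 * S i)%nat with (S k + S d - 2 * S i)%nat by lia.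
    replace (k + d - 2 * i)%nat with (S k + S d - 2 * S i)%nat by lia.
    replace (S m + i)%nat with (m + S i)%nat by lia. ring.
Qed.

Lemma Csum_extend_0 (f : nat -> C) (n p : nat) :
  (forall i, (n <= i)%nat -> f i = 0) -> Csum f (n + p) = Csum f n.
Proof.
intros H. induction p as [|p IH]; [now rewrite Nat.add_0_r|].
rewrite Nat.add_succ_r. simpl. rewrite IH, H by lia. ring.
Qed.

Lemma sum_n_m_Csum (f : nat -> C) (m p : nat) :
  @sum_n_m C_AbelianMonoid f m (m + p) = Csum (fun j => f (m + j)%nat) (S p).
Proof.
induction p as [|p IH].
- rewrite Nat.add_0_r, sum_n_n. simpl. rewrite Nat.add_0_r. ring.
- rewrite Nat.add_succ_r, sum_n_Sm by lia. rewrite IH.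
  change (Csum (fun j => f (m + j)%nat) (S (S p))) with
   (Csum (fun j => f (m + j)%nat) (S p) + f (m + S p)%nat).
  now rewrite Nat.add_succ_r.
Qed.

Theorem corollary4p6 (psi : C -> C) (Q : C -> C -> C) (n m : nat) (z : C)
    (hpsi : Sigma_class psi) (hQ : is_Qe psi Q)
    (hn : (1 <= n)%nat) (hm : (m < n)%nat) (hz : De z) :
  C_partial n m Q z z =
  (RtoC (INR (n - m) / 2) *
   @sum_n_m C_AbelianMonoid
     (fun k : nat =>
        RtoC ((-1) ^ (k + m) / INR (n - k) * Binomial.C (n - k) (k - m)) *
        C_derive_n (diag_schwarzian Q k) (n + m - 2 * k) z)
     m ((m + n) / 2)%nat)%C.
Proof.
destruct hpsi as [_ [_ [b hb]]]. change (laurent_expansion psi b) in hb.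
assert (HL := is_log_quot_laurent psi b Q hb hQ).
assert (HS : forall u v, De u -> De v -> Q u v = Q v u).
{ intros u v Hu Hv. now apply Q_sym with psi b. }
set (A := fun n m u => eval (laurent_coef b) Q (partial_expr (laurent_coef b) n m) u u).
assert (HA : forall n m u, De u -> C_partial n m Q u u = A n m u).
{ intros. now apply C_partial_eval. }
assert (HB : forall k i j u, De u -> @is_derive C_AbsRing C_NormedModule
   (fun u => diag_iter (fun n m => A n m u) k i j) u (diag_iter (fun n m => A n m u) (S k) i j)).
{ intros k. induction k as [|k IH]; intros i j u Hu.
  - now apply is_derive_diag_partial.
  - apply (is_derive_plus (K := C_AbsRing) (V := C_NormedModule)
      (fun u => diag_iter (fun n m => A n m u) k (S i) j)
      (fun u => diag_iter (fun n m => A n m u) k i (S j))); now apply IH. }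
assert (HC : forall i k, C_derive_n (diag_schwarzian Q i) k z = diag_iter (fun n m => A n m z) k i i).
{ intros i k. apply (C_derive_n_family _ (fun k u => diag_iter (fun n m => A n m u) k i i)); [| |easy].
  - intros u Hu. now apply HA.
  - intros k' u Hu. now apply HB. }
rewrite HA by easy.
set (A' := fun n m => A n m z) in *.
assert (HA' : forall i j, A' i j = A' j i).
{ intros i j. now apply partial_expr_swap. }
set (d := (n - m)%nat). set (p := (d / 2)%nat).
assert (Hp : (2 * p <= d < 2 * p + 2)%nat).
{ assert (T := Nat.div_mod_eq d 2). assert (T' := Nat.mod_upper_bound d 2). fold p in T. lia. }
assert (Ep : ((m + n) / 2)%nat = (m + p)%nat).
{ symmetry. apply Nat.div_unique with ((m + n) - 2 * (m + p))%nat; unfold d in *; lia. }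
rewrite Ep, sum_n_m_Csum.
(* Order k = 0 and limit N = d, written p + (d - p) so that the vanishing terms beyond p = floor(d /
   2) can be cut off. *)
assert (L := diag_iter_lucas A' HA' d 0 m (p + (d - p)) ltac:(lia)).
replace (m + d)%nat with n in L by (unfold d; lia).
simpl diag_iter in L at 1. change (A' n m) with (A n m z) in L.
change (S (p + (d - p))) with (S p + (d - p))%nat in L.
rewrite Csum_extend_0 in L.
2: { intros i Hi. rewrite lucas_0 by lia. ring. }
assert (E2 : A n m z = RtoC (/ 2) * (2 * A n m z)).
{ rewrite RtoC_inv by lra. field. }
rewrite E2, L. rewrite <- !Csum_scal. apply Csum_ext. intros j Hj.
rewrite HC.
replace (n + m - 2 * (m + j))%nat with (0 + d - 2 * j)%nat by (unfold d; lia).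
rewrite !Cmult_assoc. f_equal. rewrite <- !RtoC_mult. f_equal.
(* Here 2j <= d because j <= p, and d >= 1 because m < n. *)
assert (F := lucas_factorial j (d - 2 * j) ltac:(lia)).
replace (2 * j + (d - 2 * j))%nat with d in F by lia.
replace (j + (d - 2 * j))%nat with (d - j)%nat in F by lia.
rewrite F. unfold Binomial.C.
replace (n - (m + j))%nat with (d - j)%nat by (unfold d; lia).
replace (m + j - m)%nat with j by lia.
replace (d - j - j)%nat with (d - 2 * j)%nat by lia.
replace ((-1) ^ (m + j + m))%R with ((-1) ^ j)%R.
2: { replace (m + j + m)%nat with (j + 2 * m)%nat by lia. rewrite pow_add, pow_1_even. ring. }
fold d. field. repeat split; try apply INR_fact_neq_0. apply not_0_INR. lia.
Qed.
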